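(* Let $\bar x\in\mathcal F(\bar\omega)$. 1. Suppose that property $R_1$ holds and that there does not exist a triple $(u,\lambda,\mu)\in\mathbb R^n\times\mathbb R^m\times\mathbb R^m$ satisfying all of (a) $0\neq u\in T^{\rm lin}_{\bar\omega}(\bar x)$, (b) $\lambda\in N(q(\bar x,\bar\omega);P;\nabla_xq(\bar x,\bar\omega)u)$, (c) $\mu\in T\big(\lambda;N(q(\bar x,\bar\omega);P;\nabla_xq(\bar x,\bar\omega)u)\big)$, (d) $F(\bar x,\bar\omega)+\nabla_xq(\bar x,\bar\omega)^T\lambda=0$, (e) $\nabla_xF(\bar x,\bar\omega)u+\nabla_x^2(\lambda^Tq)(\bar x,\bar\omega)u+\nabla_xq(\bar x,\bar\omega)^T\mu=0$. Then there are neighborhoods $U$ of $\bar x$, $W$ of $\bar\omega$ and a constant $L>0$ such that $$(\hat S(\omega)\cup\hat S_M(\omega))\cap U\subset\bar x+L\hat\tau_1(\omega)\mathcal B_{\mathbb R^n}\quad\forall\omega\in W.$$ 2. Suppose that property $R_2$ holds and that there does not exist a quadruple $(u,\lambda,\mu,v)\in\mathbb R^n\times\mathbb R^m\times\mathbb R^m\times\mathbb R^n$ such that $(u,\lambda,\mu)$ satisfies (a)-(e) and (f) $\nabla_xq(\bar x,\bar\omega)v+u^T\nabla_x^2q(\bar x,\bar\omega)u\in T\big(q(\bar x,\bar\omega);\bigcup_{i\in\mathcal I(u)}P_i\big)$, (g) $u^T\nabla_x^2(\lambda^Tq)(\bar x,\bar\omega)u=F(\bar x,\bar\omega)^Tv$,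 where $\mathcal I(u):=\{i\mid\nabla_xq(\bar x,\bar\omega)u\in T(q(\bar x,\bar\omega);P_i)\}$. Then there are neighborhoods $U$ of $\bar x$, $W$ of $\bar\omega$ and a constant $L>0$ such that $$(\hat S(\omega)\cup\hat S_M(\omega))\cap U\subset\bar x+L\hat\tau_2(\omega)\mathcal B_{\mathbb R^n}\quad\forall\omega\in W.$$
   Context: Setting. $\Omega$ is a topological space, $\bar\omega\in\Omega$, $\bar x\in\mathbb R^n$; $q:\mathbb R^n\times\Omega\to\mathbb R^m$ and $F:\mathbb R^n\times\Omega\to\mathbb R^n$ are continuous; $P=\bigcup_{i=1}^pP_i\subset\mathbb R^m$ is a finite union of convex polyhedra $P_i=\{y\mid a_{ij}^Ty\le b_{ij},\ j=1,\dots,m_i\}$. $\mathcal F(\omega):=\{x\in\mathbb R^n\mid q(x,\omega)\in P\}$. $\|\cdot\|$ is the Euclidean norm (and the associated operator norm for derivatives), $\mathcal B_{\mathbb R^n}$ the closed unit ball. Standing assumption. There are neighborhoods $U_0$ of $\bar x$ and $W_0$ of $\bar\omega$ such that on $U_0\times W_0$ $q$ is twice partially differentiable with respect to $x$ and $F$ is partially differentiable with respect to $x$; $F,q,\nabla_xq,\nabla_xF,\nabla_x^2q$ are continuous at $(\bar x,\bar\omega)$; and $\nabla_x^2q(\cdot,\omega)$ is continuous on $U_0$ for every $\omega\in W_0$. Cones. For $\Gamma\subset\mathbb R^d$ and $x\in\Gamma$: the contingent cone is $T(x;\Gamma):=\{u\mid\exists u_k\to u,\ t_k\downarrow0:\ x+t_ku_k\in\Gamma\}$;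 the regular (Fréchet) normal cone is $\hat N(x;\Gamma):=\{\xi\mid\limsup_{x'\to x,\,x'\in\Gamma}\xi^T(x'-x)/\|x'-x\|\le0\}$; the limiting normal cone is $N(x;\Gamma):=\{\xi\mid\exists x_k\to x,\ x_k\in\Gamma,\ \xi_k\to\xi:\ \xi_k\in\hat N(x_k;\Gamma)\}$; the limiting normal cone in direction $u$ is $N(x;\Gamma;u):=\{\xi\mid\exists t_k\downarrow0,\ u_k\to u,\ \xi_k\to\xi:\ \xi_k\in\hat N(x+t_ku_k;\Gamma)\ \forall k\}$. All of these are empty if the base point is not in $\Gamma$. Notation. $T^{\rm lin}_\omega(x):=\{u\in\mathbb R^n\mid\nabla_xq(x,\omega)u\in T(q(x,\omega);P)\}$. $u^T\nabla_x^2q(\bar x,\bar\omega)u\in\mathbb R^m$ is the vector with components $u^T\nabla_x^2q_i(\bar x,\bar\omega)u$, and $(\lambda^Tq)(x,\omega):=\lambda^Tq(x,\omega)$. For $l\in\{1,2\}$, $$e_l(\omega):=\|\nabla_xq(\bar x,\omega)-\nabla_xq(\bar x,\bar\omega)\|+\|q(\bar x,\omega)-q(\bar x,\bar\omega)\|^{1/l},\qquad\hat\tau_l(\omega):=\|F(\bar x,\omega)-F(\bar x,\bar\omega)\|+e_l(\omega).$$ Solution maps. $\hat S(\omega):=\{x\mid0\in F(x,\omega)+\hat N(x;\mathcal F(\omega))\}$ and $\hat S_M(\omega):=\{x\mid0\in F(x,\omega)+\nabla_xq(x,\omega)^TN(q(x,\omega);P)\}$ (only points near $\bar x$, where the derivatives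 exist, matter). Property $R_l$ ($l\in\{1,2\}$). Let $M_\omega(x):=q(x,\omega)-P$. A multifunction $M:\mathbb R^n\rightrightarrows\mathbb R^m$ is metrically regular with modulus $\kappa>0$ around $(x_0,y_0)\in{\rm gph}\,M$ if there are neighborhoods $U'$ of $x_0$ and $V'$ of $y_0$ with ${\rm d}(x,M^{-1}(y))\le\kappa\,{\rm d}(y,M(x))$ for all $(x,y)\in U'\times V'$. Property $R_l$ holds if there are neighborhoods $U$ of $\bar x$, $W$ of $\bar\omega$ and constants $\kappa>0$, $\gamma>0$ such that for every $\omega\in W$ and every $x\in\mathcal F(\omega)\cap U$ with $\|x-\bar x\|>\gamma e_l(\omega)$ the multifunction $M_\omega$ is metrically regular with modulus $\kappa$ around $(x,0)$. *)

(* Defs.v *)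
From HB Require Import structures.
From mathcomp Require Import all_boot all_order all_algebra.
From mathcomp Require Import all_classical all_reals all_analysis.
Set Implicit Arguments.
Unset Strict Implicit.
Unset Printing Implicit Defensive.
Import Order.TTheory GRing.Theory Num.Theory.
Import numFieldNormedType.Exports.
Local Open Scope classical_set_scope.
Local Open Scope ring_scope.

(* Elements of R^d are row vectors ['rV[R]_d].  In keeping with the library   *)
(* Jacobian ['J f x] : 'M_(n, m), which acts on the right of row vectors, the *)
(* product (nabla f(x)) u is [u *m 'J f x] and (nabla f(x))^T lambda is       *)
(* [lambda *m ('J f x)^T].  The norm that the library puts on matrices is the *)
(* sup norm; it is used here only through the topology it induces, which is   *)
(* the Euclidean one, and [enorm] is the Euclidean norm.                      *)

Definition dotp (R : realType) (d : nat) (u v : 'rV[R]_d) : R :=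
  (u *m v^T) 0 0.

Definition enorm (R : realType) (d : nat) (u : 'rV[R]_d) : R :=
  Num.sqrt (dotp u u).

Definition unit_eball (R : realType) (d : nat) : set 'rV[R]_d :=
  [set u | enorm u <= 1].

Definition opnorm (R : realType) (n m : nat) (A : 'M[R]_(n, m)) : R :=
  sup [set enorm (u *m A) | u in @unit_eball R n].

(* Equal to +oo when [A] is empty. *)
Definition edist_set (R : realType) (d : nat) (x : 'rV[R]_d)
    (A : set 'rV[R]_d) : \bar R :=
  ereal_inf [set (enorm (x - a))%:E | a in A].

Definition is_polyhedron (R : realType) (d : nat) (A : set 'rV[R]_d) : Prop :=
  exists (k : nat) (a : 'I_k -> 'rV[R]_d) (b : 'I_k -> R),
    A = [set y | forall j, dotp (a j) y <= b j].

(* t_k \downarrow 0; requiring the sequence to be monotone as well would not  *)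
(* change the cones below (pass to a subsequence).                            *)
Definition decr_to0 (R : realType) (t : nat -> R) : Prop :=
  (forall k, 0 < t k) /\ t @ \oo --> (0 : R).

Definition contingent_cone (R : realType) (d : nat) (x : 'rV[R]_d)
    (G : set 'rV[R]_d) : set 'rV[R]_d :=
  [set u | G x /\
    exists (t : nat -> R) (us : nat -> 'rV[R]_d),
      [/\ decr_to0 t, us @ \oo --> u & forall k, G (x + t k *: us k)]].

(* When [x] is an isolated point of [G] the filter is improper, the limsup is *)
(* -oo and the cone is the whole space.                                       *)
Definition regular_normal (R : realType) (d : nat) (x : 'rV[R]_d)
    (G : set 'rV[R]_d) : set 'rV[R]_d :=
  [set xi | G x /\
    (limf_esup (fun y : 'rV[R]_d => (dotp xi (y - x) / enorm (y - x))%:E)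
               (within G x^') <= 0)%E].

Definition limiting_normal (R : realType) (d : nat) (x : 'rV[R]_d)
    (G : set 'rV[R]_d) : set 'rV[R]_d :=
  [set xi | G x /\
    exists xs xis : nat -> 'rV[R]_d,
      [/\ xs @ \oo --> x, forall k, G (xs k), xis @ \oo --> xi &
          forall k, regular_normal (xs k) G (xis k)]].

Definition dir_limiting_normal (R : realType) (d : nat) (x : 'rV[R]_d)
    (G : set 'rV[R]_d) (u : 'rV[R]_d) : set 'rV[R]_d :=
  [set xi | G x /\
    exists (t : nat -> R) (us xis : nat -> 'rV[R]_d),
      [/\ decr_to0 t, us @ \oo --> u, xis @ \oo --> xi &
          forall k, regular_normal (x + t k *: us k) G (xis k)]].

Definition metrically_regular (R : realType) (n m : nat)
    (M : 'rV[R]_n -> set 'rV[R]_m) (kappa : R)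
    (x0 : 'rV[R]_n) (y0 : 'rV[R]_m) : Prop :=
  M x0 y0 /\
  exists (U : set 'rV[R]_n) (V : set 'rV[R]_m),
    [/\ nbhs x0 U, nbhs y0 V &
        forall x y, U x -> V y ->
          (edist_set x [set x' | M x' y] <=
             kappa%:E * edist_set y (M x))%E].

Definition gradient (R : realType) (n : nat) (g : 'rV[R]_n -> R)
    (x : 'rV[R]_n) : 'rV[R]_n :=
  \row_j ('d g x (delta_mx 0 j) : R).

Definition hessian (R : realType) (n : nat) (g : 'rV[R]_n -> R)
    (x : 'rV[R]_n) : 'M[R]_n :=
  'J (gradient g) x.

(* u^T (nabla^2 g(x)) u *)
Definition hess_form (R : realType) (n : nat) (g : 'rV[R]_n -> R)
    (x u : 'rV[R]_n) : R :=
  dotp (u *m hessian g x) u.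

Definition jac_x (R : realType) (n k : nat) (Omega : Type)
    (f : 'rV[R]_n -> Omega -> 'rV[R]_k) (x : 'rV[R]_n) (w : Omega) :
    'M[R]_(n, k) :=
  'J (f ^~ w) x.

Definition hess_x (R : realType) (n m : nat) (Omega : Type)
    (q : 'rV[R]_n -> Omega -> 'rV[R]_m) (i : 'I_m)
    (x : 'rV[R]_n) (w : Omega) : 'M[R]_n :=
  hessian (fun x' => q x' w 0 i) x.

Definition standing_assumption (R : realType) (n m : nat)
    (Omega : topologicalType)
    (q : 'rV[R]_n -> Omega -> 'rV[R]_m) (F : 'rV[R]_n -> Omega -> 'rV[R]_n)
    (xbar : 'rV[R]_n) (wbar : Omega) : Prop :=
  exists (U0 : set 'rV[R]_n) (W0 : set Omega),
    [/\ nbhs xbar U0,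
        nbhs wbar W0,
        forall x w, U0 x -> W0 w ->
          [/\ differentiable (q ^~ w) x,
              differentiable (fun x' => jac_x q x' w) x &
              differentiable (F ^~ w) x],
        [/\ {for (xbar, wbar),
               continuous (fun z : 'rV[R]_n * Omega => F z.1 z.2)},
            {for (xbar, wbar),
               continuous (fun z : 'rV[R]_n * Omega => q z.1 z.2)},
            {for (xbar, wbar),
               continuous (fun z : 'rV[R]_n * Omega => jac_x q z.1 z.2)},
            {for (xbar, wbar),
               continuous (fun z : 'rV[R]_n * Omega => jac_x F z.1 z.2)} &
            forall i : 'I_m, {for (xbar, wbar),
               continuous (fun z : 'rV[R]_n * Omega => hess_x q i z.1 z.2)}] &
        forall w, W0 w -> forall i : 'I_m,
          {within U0, continuous (fun x => hess_x q i x w)}].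

Definition feasible (R : realType) (n m : nat) (Omega : Type)
    (q : 'rV[R]_n -> Omega -> 'rV[R]_m) (P : set 'rV[R]_m) (w : Omega) :
    set 'rV[R]_n :=
  [set x | P (q x w)].

Definition lin_cone (R : realType) (n m : nat) (Omega : Type)
    (q : 'rV[R]_n -> Omega -> 'rV[R]_m) (P : set 'rV[R]_m) (w : Omega)
    (x : 'rV[R]_n) : set 'rV[R]_n :=
  [set u | contingent_cone (q x w) P (u *m jac_x q x w)].

Definition e_ (R : realType) (n m : nat) (Omega : Type)
    (q : 'rV[R]_n -> Omega -> 'rV[R]_m) (xbar : 'rV[R]_n) (wbar : Omega)
    (l : nat) (w : Omega) : R :=
  opnorm (jac_x q xbar w - jac_x q xbar wbar) +
  enorm (q xbar w - q xbar wbar) `^ (l%:R^-1).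

Definition tau_hat (R : realType) (n m : nat) (Omega : Type)
    (q : 'rV[R]_n -> Omega -> 'rV[R]_m) (F : 'rV[R]_n -> Omega -> 'rV[R]_n)
    (xbar : 'rV[R]_n) (wbar : Omega) (l : nat) (w : Omega) : R :=
  enorm (F xbar w - F xbar wbar) + e_ q xbar wbar l w.

Definition S_hat (R : realType) (n m : nat) (Omega : Type)
    (q : 'rV[R]_n -> Omega -> 'rV[R]_m) (F : 'rV[R]_n -> Omega -> 'rV[R]_n)
    (P : set 'rV[R]_m) (w : Omega) : set 'rV[R]_n :=
  [set x | exists2 xi, regular_normal x (feasible q P w) xi &
                       0 = F x w + xi].

Definition S_hat_M (R : realType) (n m : nat) (Omega : Type)
    (q : 'rV[R]_n -> Omega -> 'rV[R]_m) (F : 'rV[R]_n -> Omega -> 'rV[R]_n)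
    (P : set 'rV[R]_m) (w : Omega) : set 'rV[R]_n :=
  [set x | exists2 lambda, limiting_normal (q x w) P lambda &
                           0 = F x w + lambda *m (jac_x q x w)^T].

Definition property_R (R : realType) (n m : nat) (Omega : topologicalType)
    (q : 'rV[R]_n -> Omega -> 'rV[R]_m) (P : set 'rV[R]_m)
    (xbar : 'rV[R]_n) (wbar : Omega) (l : nat) : Prop :=
  exists (U : set 'rV[R]_n) (W : set Omega) (kappa gamma : R),
    [/\ nbhs xbar U, nbhs wbar W, 0 < kappa, 0 < gamma &
        forall w x, W w -> (feasible q P w `&` U) x ->
          gamma * e_ q xbar wbar l w < enorm (x - xbar) ->
          metrically_regular (fun x' => [set q x' w - y | y in P])
            kappa x 0].

Definition critical_triple (R : realType) (n m : nat) (Omega : Type)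
    (q : 'rV[R]_n -> Omega -> 'rV[R]_m) (F : 'rV[R]_n -> Omega -> 'rV[R]_n)
    (P : set 'rV[R]_m) (xbar : 'rV[R]_n) (wbar : Omega)
    (u : 'rV[R]_n) (lambda mu : 'rV[R]_m) : Prop :=
  let J := jac_x q xbar wbar in
  let N := dir_limiting_normal (q xbar wbar) P (u *m J) in
  [/\ u <> 0 /\ lin_cone q P wbar xbar u,
      N lambda,
      contingent_cone lambda N mu,
      F xbar wbar + lambda *m J^T = 0 &
      u *m jac_x F xbar wbar
        + u *m hessian (fun x => dotp lambda (q x wbar)) xbar
        + mu *m J^T = 0].

Definition active_pieces (R : realType) (n m p : nat) (Omega : Type)
    (q : 'rV[R]_n -> Omega -> 'rV[R]_m) (P_ : 'I_p -> set 'rV[R]_m)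
    (xbar : 'rV[R]_n) (wbar : Omega) (u : 'rV[R]_n) : set 'I_p :=
  [set i | contingent_cone (q xbar wbar) (P_ i) (u *m jac_x q xbar wbar)].

Definition second_order_cond (R : realType) (n m p : nat) (Omega : Type)
    (q : 'rV[R]_n -> Omega -> 'rV[R]_m) (F : 'rV[R]_n -> Omega -> 'rV[R]_n)
    (P_ : 'I_p -> set 'rV[R]_m) (xbar : 'rV[R]_n) (wbar : Omega)
    (u : 'rV[R]_n) (lambda : 'rV[R]_m) (v : 'rV[R]_n) : Prop :=
  contingent_cone (q xbar wbar)
    (\bigcup_(i in active_pieces q P_ xbar wbar u) P_ i)
    (v *m jac_x q xbar wbar
       + \row_i hess_form (fun x => q x wbar 0 i) xbar u) /\
  hess_form (fun x => dotp lambda (q x wbar)) xbar u = dotp (F xbar wbar) v.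

Definition local_upper_estimate (R : realType) (n m : nat)
    (Omega : topologicalType)
    (q : 'rV[R]_n -> Omega -> 'rV[R]_m) (F : 'rV[R]_n -> Omega -> 'rV[R]_n)
    (P : set 'rV[R]_m) (xbar : 'rV[R]_n) (wbar : Omega) (l : nat) : Prop :=
  exists (U : set 'rV[R]_n) (W : set Omega) (L : R),
    [/\ nbhs xbar U, nbhs wbar W, 0 < L &
        forall w, W w ->
          (S_hat q F P w `|` S_hat_M q F P w) `&` U `<=`
          [set xbar + (L * tau_hat q F xbar wbar l w) *: z |
             z in @unit_eball R n]].

(* Main.v *)
Require Import Defs.
From HB Require Import structures.
From mathcomp Require Import all_boot all_order all_algebra.
From mathcomp Require Import all_classical all_reals all_analysis.
From mathcomp Require Import ring lra.
Set Implicit Arguments.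
Unset Strict Implicit.
Unset Printing Implicit Defensive.
Import Order.TTheory GRing.Theory Num.Theory.
Import numFieldNormedType.Exports.
Local Open Scope classical_set_scope.
Local Open Scope ring_scope.

(** The estimate is proved by contradiction, through a blow-up at (xbar, wbar). If
    it fails, there are parameters w near wbar and stationary points x near xbar for
    which tau_hat w is o(t), where t = |x - xbar| > 0. At the scale t the
    perturbation of F, of q and of the Jacobian of q is then invisible, and for
    l = 2 the perturbation of q is invisible even at the scale t^2.

    The regularity property applies at the points x. It bounds multipliers by the
    gradients that they produce (multiplier_bound), and it represents regular normals
    to the feasible set, up to arbitrarily small errors, by regular normals to P at
    points near q x w (regular_normal_preimage_multiplier, by quadratic
    penalisation). Hence both kinds of stationarity provide a point y of P with
    y = q x w + o(t^2) and a bounded regular normal lam to P at y such that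
    F x w + lam J^T = o(t), where J is the Jacobian (approximate_multiplier).

    As P is a finite union of polyhedra, its regular normal cones take finitely many
    values near q xbar wbar and are polyhedral. In the limit the cone at y may be
    taken constant, equal to K say, while (x - xbar) / t tends to some u of norm one
    and lam tends to some lam0 in K. With ybar = q xbar wbar and A the Jacobian at
    (xbar, wbar), one has y = ybar + t (u A + o(1)). Thus u A is tangent to P at ybar,
    and every element of K is a limiting normal in the direction u A. Passing to the
    limit in the stationarity equation gives the first-order condition on lam0;
    subtracting this condition and dividing by t shows that (lam - lam0) A^T / t
    converges to the negative of the second-order terms. The quotients
    (lam - lam0) / t belong to the tangent cone of K at lam0, which is polyhedral, so
    that its image under A^T is closed (pcone_image_limit). The limit is therefore
    mu A^T for some mu in this tangent cone, and (u, lam0, mu) is a critical triple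
    (exists_critical_multiplier).

    For l = 2 the points y may be assumed to lie in one polyhedron. Then lam0 is
    orthogonal to y - ybar, and the second-order expansion of y, together with one
    more closedness argument for linear images of polyhedral cones, yields the
    vector v (exists_second_order).

    The facts on polyhedral cones all follow from Fourier-Motzkin elimination
    (pcone_elim_ray). Limits are taken along an ultrafilter on the tuples
    (x, w, y, lam): the parameter space may lack countable neighbourhood bases, and
    an ultrafilter makes extractions of subsequences superfluous. Estimates use the
    sup norm of row vectors, which is equivalent to the Euclidean one. *)

(** * Euclidean and sup norms *)

Section InnerProduct.
Variables (R : realType) (d : nat).
Implicit Types (u v w : 'rV[R]_d) (c : R).

Lemma dotpE u v : dotp u v = \sum_i u 0 i * v 0 i.
Proof. by rewrite /dotp mxE; apply: eq_bigr => i _; rewrite mxE. Qed.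

Lemma dotpC u v : dotp u v = dotp v u.
Proof. by rewrite !dotpE; apply: eq_bigr => i _; rewrite mulrC. Qed.

Lemma dotpDl u v w : dotp (u + v) w = dotp u w + dotp v w.
Proof. by rewrite /dotp mulmxDl mxE. Qed.

Lemma dotpZl c u v : dotp (c *: u) v = c * dotp u v.
Proof. by rewrite /dotp -scalemxAl mxE. Qed.

Lemma dotpNl u v : dotp (- u) v = - dotp u v.
Proof. by rewrite /dotp mulNmx mxE. Qed.

Lemma dotpBl u v w : dotp (u - v) w = dotp u w - dotp v w.
Proof. by rewrite dotpDl dotpNl. Qed.

Lemma dotpDr u v w : dotp w (u + v) = dotp w u + dotp w v.
Proof. by rewrite dotpC dotpDl !(dotpC w). Qed.

Lemma dotpZr c u v : dotp u (c *: v) = c * dotp u v.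
Proof. by rewrite dotpC dotpZl (dotpC u). Qed.

Lemma dotpNr u v : dotp u (- v) = - dotp u v.
Proof. by rewrite dotpC dotpNl (dotpC u). Qed.

Lemma dotpBr u v w : dotp w (u - v) = dotp w u - dotp w v.
Proof. by rewrite dotpDr dotpNr. Qed.

Lemma dotp0l u : dotp 0 u = 0.
Proof. by rewrite /dotp mul0mx mxE. Qed.

Lemma dotp0r u : dotp u 0 = 0.
Proof. by rewrite dotpC dotp0l. Qed.

Lemma dotp_delta u i : dotp u (delta_mx 0 i) = u 0 i.
Proof. by rewrite dotpC /dotp -rowE !mxE. Qed.

Lemma coord_le_norm m (A : 'M[R]_(m, d)) i j : `|A i j| <= `|A|.
Proof.
rewrite [leRHS]/Num.norm /= mx_normrE.
exact: (@le_bigmax _ _ _ 0 (fun ij : 'I_m * 'I_d => `|A ij.1 ij.2|) (i, j)).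
Qed.

Lemma norm_le_coord m (A : 'M[R]_(m, d)) c : 0 <= c ->
  (forall i j, `|A i j| <= c) -> `|A| <= c.
Proof.
move=> c0 Ac; rewrite [leLHS]/Num.norm /= mx_normrE.
by apply: bigmax_le => // -[i j] _; exact: Ac.
Qed.

Lemma norm_dotp_le u v : `|dotp u v| <= d%:R * `|u| * `|v|.
Proof.
rewrite dotpE (le_trans (ler_norm_sum _ _ _)) //.
rewrite -mulrA mulr_natl -[X in _ *+ X]card_ord -sumr_const.
by apply: ler_sum => i _; rewrite normrM ler_pM // coord_le_norm.
Qed.

Lemma dotp_le u v : dotp u v <= d%:R * `|u| * `|v|.
Proof. exact: le_trans (ler_norm _) (norm_dotp_le u v). Qed.

Lemma dotp_ge0 u : 0 <= dotp u u.
Proof. by rewrite dotpE sumr_ge0 // => i _; rewrite -expr2 sqr_ge0. Qed.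

Lemma sqr_norm_le_dotp u : `|u| ^+ 2 <= dotp u u.
Proof.
have [->|u0] := eqVneq u 0; first by rewrite normr0 expr0n dotp_ge0.
have /mx_norm_neq0[[i j] /= uE] : mx_norm u != 0 by rewrite (normr_eq0 u).
rewrite [X in X ^+ 2]uE real_normK ?num_real// ord1 dotpE (bigD1 j) //= expr2.
by rewrite lerDl sumr_ge0 // => k _; rewrite -expr2 sqr_ge0.
Qed.

Lemma enormE u : enorm u ^+ 2 = dotp u u.
Proof. by rewrite sqr_sqrtr ?dotp_ge0. Qed.

Lemma enorm_ge0 u : 0 <= enorm u.
Proof. exact: sqrtr_ge0. Qed.

Lemma norm_le_enorm u : `|u| <= enorm u.
Proof.
by rewrite -(@ler_pXn2r _ 2) ?nnegrE ?enorm_ge0 // enormE sqr_norm_le_dotp.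
Qed.

(** The crude constant d + 1 spares a square root, and it is positive even when
    d = 0, so that it can be multiplied into a regularity modulus. *)
Lemma enorm_le_norm u : enorm u <= d.+1%:R * `|u|.
Proof.
rewrite -(@ler_pXn2r _ 2) ?nnegrE ?enorm_ge0 ?mulr_ge0 // enormE.
apply: le_trans (dotp_le u u) _; rewrite -mulrA -expr2 exprMn.
by rewrite ler_wpM2r ?sqr_ge0// -natrX ler_nat (leq_trans (leqnSn _)) ?leq_pmulr.
Qed.

Lemma enormZ c u : enorm (c *: u) = `|c| * enorm u.
Proof. by rewrite /enorm dotpZl dotpZr mulrA -expr2 sqrtrM ?sqr_ge0// sqrtr_sqr. Qed.

End InnerProduct.

Lemma dotp_mulmx (R : realType) n m (u : 'rV[R]_n) (A : 'M[R]_(n, m)) v :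
  dotp (u *m A) v = dotp u (v *m A^T).
Proof. by rewrite /dotp trmx_mul trmxK mulmxA. Qed.

Lemma norm_mulmx_le (R : realType) m n p (A : 'M[R]_(m, n)) (B : 'M[R]_(n, p)) :
  `|A *m B| <= n%:R * `|A| * `|B|.
Proof.
apply: norm_le_coord => [|i j]; first by rewrite !mulr_ge0.
rewrite mxE (le_trans (ler_norm_sum _ _ _)) //.
rewrite -mulrA mulr_natl -[X in _ *+ X]card_ord -sumr_const.
by apply: ler_sum => k _; rewrite normrM ler_pM // coord_le_norm.
Qed.

(** * Polyhedral cones *)

Section PolyhedralCones.
Variables (R : realType) (d : nat).
Implicit Types (x v xi : 'rV[R]_d) (s : seq 'rV[R]_d).

(** A polyhedral cone is represented by the list of its outer normals, on which
    intersection and elimination are list operations. *)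
Definition pcone s : set 'rV[R]_d := [set x | {in s, forall a, dotp a x <= 0}].

Definition polar (A : set 'rV[R]_d) : set 'rV[R]_d :=
  [set xi | forall x, A x -> dotp xi x <= 0].

(** The recursion makes every generator one elimination step. *)
Fixpoint gcone s : set 'rV[R]_d :=
  if s is v :: s' then [set x | exists2 c, 0 <= c & gcone s' (x - c *: v)]
  else [set 0].

Lemma pconeD s x v : pcone s x -> pcone s v -> pcone s (x + v).
Proof. by move=> sx sv a sa; rewrite dotpDr -[0]addr0 lerD ?sx ?sv. Qed.

Lemma pconeZ s c x : 0 <= c -> pcone s x -> pcone s (c *: x).
Proof. by move=> c0 sx a sa; rewrite dotpZr mulr_ge0_le0 // sx. Qed.

Lemma pcone_bigcap (I : eqType) (r : seq I) (f : I -> seq 'rV[R]_d) x :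
  pcone (flatten [seq f i | i <- r]) x <-> {in r, forall i, pcone (f i) x}.
Proof.
split=> [fx i ri a fa|fx a /flatten_mapP[i ri fa]]; last exact: fx fa.
by apply: fx; apply/flatten_mapP; exists i.
Qed.

(** Fourier-Motzkin elimination of the coefficient c >= 0 of v. The inequalities
    whose normal a has a.v <= 0 survive because a.(x - c v) <= 0 then forces
    a.x <= 0; two inequalities with a.v of opposite signs are combined with the
    weights for which v cancels. *)
Definition elim_ray v s : seq 'rV[R]_d :=
  [seq a <- s | dotp a v <= 0] ++
  [seq dotp a v *: b - dotp b v *: a
     | a <- [seq a <- s | 0 < dotp a v], b <- [seq b <- s | dotp b v < 0]].

(** A coefficient c is admissible when it is above 0 and above all quotients
    a.x / a.v with a.v > 0, and below all those with a.v < 0. The combined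
    inequalities express that every lower bound is at most every upper bound. *)
Lemma pcone_elim_ray v s :
  [set x | exists2 c, 0 <= c & pcone s (x - c *: v)] = pcone (elim_ray v s).
Proof.
apply/seteqP; split=> [x [c c0 sx]|x sx].
  have sE a : a \in s -> dotp a x <= c * dotp a v.
    by move=> /sx; rewrite dotpBr dotpZr subr_le0.
  move=> e; rewrite mem_cat => /orP[|/allpairsP[[a b] /=]].
    rewrite mem_filter => /andP[av sa]; apply: le_trans (sE _ sa) _.
    by rewrite mulr_ge0_le0.
  rewrite !mem_filter => -[/andP[av sa] /andP[bv sb] ->].
  rewrite dotpBl !dotpZl subr_le0.
  have := sE _ sa; have := sE _ sb; nra.
(* the largest lower bound on the coefficient of v *)
pose c := \big[Num.max/0]_(a <- s | 0 < dotp a v) (dotp a x / dotp a v).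
exists c; first by rewrite /c; elim/big_rec: _ => // a y _ y0; rewrite le_max y0 orbT.
move=> b sb; rewrite dotpBr dotpZr subr_le0.
have [bv|bv|bv] := ltgtP (dotp b v) 0; last first.
- rewrite bv mulr0; apply: sx; rewrite mem_cat mem_filter sb bv lexx //.
- rewrite -ler_pdivrMr // /c.
  exact: (@le_bigmax_seq _ _ _ _ _ b (fun a => 0 < dotp a v)
            (fun a => dotp a x / dotp a v)).
rewrite -ler_ndivlMr // /c big_seq_cond.
elim/big_ind: _ => [|y z yx zx|a /andP[sa av]].
- rewrite -mulrNN mulr_ge0 //; last by rewrite oppr_ge0 invr_le0 ltW.
  by rewrite oppr_ge0; apply: sx; rewrite mem_cat mem_filter sb ltW.
- by rewrite ge_max yx zx.
rewrite ler_pdivrMr // mulrAC ler_ndivlMr //.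
have /sx : dotp a v *: b - dotp b v *: a \in elim_ray v s.
  rewrite mem_cat; apply/orP; right; apply/allpairsP.
  by exists (a, b); rewrite !mem_filter /= sa sb av bv.
by rewrite dotpBl !dotpZl subr_le0 (mulrC (dotp b x)) (mulrC (dotp a x)).
Qed.

Lemma pcone_singleton0 : exists s, pcone s = [set 0].
Proof.
exists ([seq delta_mx 0 i | i : 'I_d] ++ [seq - delta_mx 0 i | i : 'I_d]).
apply/seteqP; split=> [x sx|x -> a _]; last by rewrite dotp0r.
apply/rowP => i; rewrite mxE; apply/eqP; rewrite eq_le.
rewrite -dotp_delta dotpC sx ?mem_cat ?map_f -?enumT ?mem_enum //=.
rewrite -oppr_le0 -dotpNl sx // mem_cat orbC.
by apply/orP; left; apply/mapP; exists i; rewrite // mem_enum.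
Qed.

Lemma pcone_add_gcone g s : exists s',
  [set x | exists2 y, gcone g y & pcone s (x - y)] = pcone s'.
Proof.
elim: g => [|v g [s' s'E]].
  exists s; apply/seteqP; split=> [x [_ ->]|x sx]; first by rewrite subr0.
  by exists 0 => //; rewrite subr0.
exists (elim_ray v s'); rewrite -pcone_elim_ray -s'E.
apply/seteqP; split=> [x [y [c c0 gy] sx]|x [c c0 [y gy sx]]].
  by exists c => //; exists (y - c *: v) => //; rewrite opprB addrA subrK.
exists (c *: v + y); last by rewrite opprD addrA.
by exists c => //; rewrite addrC addKr.
Qed.

(** Weyl: generated cones are polyhedral, by elimination from the cone {0}. *)
Lemma gcone_pcone g : exists s, gcone g = pcone s.
Proof.
have [s0 s0E] := pcone_singleton0.
have [s' s'E] := pcone_add_gcone g s0; exists s'.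
rewrite -s'E s0E; apply/seteqP; split=> [x gx|x [y gy /= /subr0_eq ->]] //.
by exists x => //=; rewrite subrr.
Qed.

Lemma gcone0 g : gcone g 0.
Proof. by elim: g => //= v g g0; exists 0; rewrite // scale0r subr0. Qed.

Lemma mem_gcone g v : v \in g -> gcone g v.
Proof.
elim: g => //= w g IH; rewrite inE => /orP[/eqP <-|/IH gv].
  by exists 1; rewrite // scale1r subrr; exact: gcone0.
by exists 0; rewrite // scale0r subr0.
Qed.

Lemma gcone_dotp g xi y : {in g, forall a, dotp xi a <= 0} -> gcone g y ->
  dotp xi y <= 0.
Proof.
elim: g y => [|v g IH] y gxi /=; first by move=> ->; rewrite dotp0r.
move=> [c c0 /IH]; rewrite dotpBr dotpZr subr_le0 => yv.
have vxi : dotp xi v <= 0 by rewrite gxi ?mem_head.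
apply: le_trans (mulr_ge0_le0 c0 vxi).
by apply: yv => a ga; rewrite gxi // inE ga orbT.
Qed.

(** Farkas. The outer normals of gcone s belong to pcone s, since gcone s contains
    the generators s; a functional that is nonpositive on pcone s is therefore
    nonpositive on them, which means that it lies in gcone s. *)
Lemma polar_pcone s : exists s', polar (pcone s) = pcone s'.
Proof.
have [s' s'E] := gcone_pcone s; exists s'; apply/seteqP; split=> [xi sxi b s'b|].
  rewrite dotpC; apply: sxi => a sa; rewrite dotpC.
  have : pcone s' a by rewrite -s'E; exact: mem_gcone.
  exact.
rewrite -s'E => xi gxi x sx; rewrite dotpC; apply: gcone_dotp gxi => a sa.
by rewrite dotpC sx.
Qed.

End PolyhedralCones.

(** * Limits along filters *)

Section ConeLimits.
Context {R : realType} {T : Type} {F : set_system T} {FF : ProperFilter F}.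

Lemma cvg_coord m n (f : T -> 'M[R]_(m, n)) (A : 'M[R]_(m, n)) i j :
  f @ F --> A -> (f t i j) @[t --> F] --> A i j.
Proof.
move=> fA; apply/cvgrPdist_lt => e e0; near=> t.
apply: le_lt_trans (_ : `|A - f t| < e).
  have -> : A i j - f t i j = (A - f t) i j by rewrite !mxE.
  exact: coord_le_norm.
by near: t; move/cvgrPdist_lt : fA; exact.
Unshelve. all: by end_near. Qed.

Lemma cvg_from_coord m n (f : T -> 'M[R]_(m, n)) (A : 'M[R]_(m, n)) :
  (forall i j, (f t i j) @[t --> F] --> A i j) -> f @ F --> A.
Proof.
move=> fA; apply/cvgrPdist_le => e e0.
have : \forall t \near F, forall i j, `|A i j - f t i j| <= e.
  apply: filter_forall => i; apply: filter_forall => j.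
  by move/cvgrPdist_le : (fA i j); exact.
apply: filterS => t fe; apply: norm_le_coord => [|i j]; first exact: ltW.
by rewrite !mxE.
Qed.

Lemma cvg_mulmx m n p (f : T -> 'M[R]_(m, n)) (g : T -> 'M[R]_(n, p))
    (A : 'M[R]_(m, n)) (B : 'M[R]_(n, p)) :
  f @ F --> A -> g @ F --> B -> (f t *m g t) @[t --> F] --> A *m B.
Proof.
move=> fA gB; apply: cvg_from_coord => i j; rewrite mxE.
under eq_fun do rewrite mxE.
by apply: cvg_big => [|k _]; [exact: add_continuous|apply: cvgM; exact: cvg_coord].
Qed.

Lemma cvg_trmx m n (f : T -> 'M[R]_(m, n)) (A : 'M[R]_(m, n)) :
  f @ F --> A -> ((f t)^T) @[t --> F] --> A^T.
Proof.
move=> fA; apply: cvg_from_coord => i j; rewrite mxE.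
by under eq_fun do rewrite mxE; exact: cvg_coord.
Qed.

Lemma cvg_dotp d (f g : T -> 'rV[R]_d) (a b : 'rV[R]_d) :
  f @ F --> a -> g @ F --> b -> dotp (f t) (g t) @[t --> F] --> dotp a b.
Proof.
by move=> fa gb; apply: cvg_coord; apply: cvg_mulmx => //; exact: cvg_trmx.
Qed.

Lemma pcone_limit d s (f : T -> 'rV[R]_d) (x : 'rV[R]_d) :
  (\forall t \near F, pcone s (f t)) -> f @ F --> x -> pcone s x.
Proof.
move=> sf fx a sa.
have /cvgr_to_le : dotp a (f t) @[t --> F] --> dotp a x.
  by apply: cvg_dotp => //; exact: cvg_cst.
by apply; apply: filterS sf => t; exact.
Qed.

(** Linear images of polyhedral cones are closed. The preimages f t may be
    unbounded, but the pseudo-inverse of B selects convergent preimages of f t *m B,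
    which differ from f t by elements of the kernel of B; the sum of the cone and
    of the kernel is again polyhedral, hence contains the limit. *)
Lemma pcone_image_limit d e s (B : 'M[R]_(d, e)) (f : T -> 'rV[R]_d) (z : 'rV[R]_e) :
  (\forall t \near F, pcone s (f t)) -> (f t *m B) @[t --> F] --> z ->
  exists2 x, pcone s x & x *m B = z.
Proof.
move=> sf fz.
(* generators of the kernel of B as a cone: the rows of kermx B with both signs *)
pose g := [seq row i (kermx B) | i : 'I_d] ++ [seq - row i (kermx B) | i : 'I_d].
have gker y : gcone g y -> y *m B = 0.
  have : {in g, forall a, a *m B = 0}.
    move=> a; rewrite mem_cat => /orP[] /mapP[i _ ->];
      by rewrite ?mulNmx -row_mul mulmx_ker row0 ?oppr0.
  elim: g y => [|v g IH] y gB /=; first by move=> ->; rewrite mul0mx.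
  move=> [c _ /IH yv]; rewrite -[y](subrK (c *: v)) mulmxDl yv ?add0r.
    by rewrite -scalemxAl (gB v) ?mem_head // scaler0.
  by move=> a ga; rewrite gB // inE ga orbT.
have kerg y : y *m B = 0 -> gcone g y.
  move=> /sub_kermxP/submxP[D ->]; rewrite mulmx_sum_row.
  have [s' s'E] := gcone_pcone g; rewrite s'E.
  apply: (big_ind (pcone s')) => [|x x'|i _]; rewrite -?s'E; first exact: gcone0.
    by rewrite s'E; exact: pconeD.
  have [D0|D0] := leP 0 (D 0 i).
    rewrite s'E; apply: pconeZ; rewrite // -s'E; apply: mem_gcone.
    by rewrite mem_cat; apply/orP; left; apply/mapP; exists i; rewrite // mem_enum.
  rewrite -[D 0 i]opprK scaleNr -scalerN s'E; apply: pconeZ; first by rewrite oppr_ge0 ltW.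
  rewrite -s'E; apply: mem_gcone; rewrite mem_cat.
  by apply/orP; right; apply/mapP; exists i; rewrite // mem_enum.
have [s' s'E] := pcone_add_gcone g s.
have fh : (f t *m B *m pinvmx B) @[t --> F] --> z *m pinvmx B.
  by apply: cvg_mulmx => //; exact: cvg_cst.
have hB t : f t *m B *m pinvmx B *m B = f t *m B by rewrite mulmxKpV ?submxMl.
have : pcone s' (z *m pinvmx B).
  apply: pcone_limit fh; apply: filterS sf => t sft; rewrite -s'E.
  exists (f t *m B *m pinvmx B - f t); last by rewrite subKr.
  by apply: kerg; rewrite mulmxBl hB subrr.
rewrite -s'E => -[y /gker yB sx]; eexists; first exact: sx.
rewrite mulmxBl yB subr0.
have : (f t *m B *m pinvmx B *m B) @[t --> F] --> z *m pinvmx B *m B.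
  by apply: cvg_mulmx => //; exact: cvg_cst.
under eq_fun do rewrite hB.
by move=> fz'; apply: (cvg_unique _ fz' fz).
Qed.

End ConeLimits.

(** * Tangent and normal cones of finite unions of polyhedra *)

Section VariationalCones.
Variables (R : realType) (d : nat).
Implicit Types (x y u xi : 'rV[R]_d) (G : set 'rV[R]_d).

(** The punctured limsup turns into an inequality with the usual epsilon, which
    holds at y = x as well; in this form the Euclidean norm may be exchanged for
    the sup norm. *)
Lemma regular_normalP x G xi : regular_normal x G xi <->
  G x /\ forall e, 0 < e ->
    \forall y \near x, G y -> dotp xi (y - x) <= e * `|y - x|.
Proof.
split=> -[Gx xiP].
  split=> // e e0.
  have e'0 : 0 < e / d.+1%:R by rewrite divr_gt0.
  have /ereal_inf_lt[_ [V FV <-] supV] :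
      (limf_esup (fun y => (dotp xi (y - x) / enorm (y - x))%:E)
        (within G x^') < (e / d.+1%:R)%:E)%E.
    by apply: le_lt_trans xiP _; rewrite lte_fin.
  have FV' : \forall y \near x, y != x -> G y -> V y by exact: FV.
  apply: filterS FV' => y yV Gy.
  have [->|yx] := eqVneq y x; first by rewrite subrr dotp0r normr0 mulr0.
  have n0 : 0 < enorm (y - x).
    by apply: lt_le_trans (norm_le_enorm _); rewrite normr_gt0 subr_eq0.
  have : ((dotp xi (y - x) / enorm (y - x))%:E < (e / d.+1%:R)%:E)%E.
    by apply: le_lt_trans supV; apply: ereal_sup_ubound; exists y => //; exact: yV.
  rewrite lte_fin ltr_pdivrMr // => /ltW/le_trans; apply.
  rewrite -mulrA ler_pM2l // ler_pdivrMl //; exact: enorm_le_norm.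
split=> //; apply/lee_addgt0Pr => e e0; rewrite add0e.
apply: (@le_trans _ _ (ereal_sup [set (dotp xi (y - x) / enorm (y - x))%:E |
    y in [set y | dotp xi (y - x) <= e * enorm (y - x)]])).
  apply: ereal_inf_lbound; eexists; last reflexivity.
  have : \forall y \near x, y != x -> G y -> dotp xi (y - x) <= e * enorm (y - x).
    apply: filterS (xiP _ e0) => y yP _ /yP/le_trans; apply.
    by rewrite ler_pM2l // norm_le_enorm.
  exact.
apply: ub_ereal_sup => _ [y yP <-]; rewrite lee_fin.
have [n0|n0] := ltP 0 (enorm (y - x)); first by rewrite ler_pdivrMr.
have -> : enorm (y - x) = 0 by apply/eqP; rewrite eq_le n0 enorm_ge0.
by rewrite invr0 mulr0 ltW.
Qed.

Lemma harmonic_small (e : R) : 0 < e -> \forall k \near \oo, k.+1%:R^-1 < e.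
Proof.
by move=> e0; have /cvgr_lt := @cvg_harmonic R; apply.
Qed.

(** The radii 1 / (k + 1) turn the epsilon form into the sequences of the
    definition. It allows tangent directions to be produced from limits along
    arbitrary filters. *)
Lemma contingent_coneI x G u : G x ->
  (forall e, 0 < e -> exists t u', [/\ 0 < t, t < e, `|u - u'| < e & G (x + t *: u')]) ->
  contingent_cone x G u.
Proof.
move=> Gx uP; split=> //.
have /choice[f fP] : forall k : nat, exists tu : R * 'rV[R]_d,
    [/\ 0 < tu.1, tu.1 < k.+1%:R^-1, `|u - tu.2| < k.+1%:R^-1 & G (x + tu.1 *: tu.2)].
  move=> k; have [|t [u' tP]] := uP k.+1%:R^-1; first by rewrite invr_gt0.
  by exists (t, u').
exists (fun k => (f k).1), (fun k => (f k).2); split.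
- split=> [k|]; first by have [] := fP k.
  apply/cvgrPdist_lt => e e0; apply: filterS (harmonic_small e0) => k ke.
  by rewrite sub0r normrN gtr0_norm; have [] := fP k => // ? /lt_trans ->.
- apply/cvgrPdist_lt => e e0; apply: filterS (harmonic_small e0) => k ke.
  by have [_ _ /lt_trans ->] := fP k.
- by move=> k; have [] := fP k.
Qed.

Lemma dir_limiting_normalI x G u xi : G x ->
  (forall e, 0 < e -> exists t u' xi', [/\ 0 < t, t < e, `|u - u'| < e,
      `|xi - xi'| < e & regular_normal (x + t *: u') G xi']) ->
  dir_limiting_normal x G u xi.
Proof.
move=> Gx uP; split=> //.
have /choice[f fP] : forall k : nat, exists tu : R * 'rV[R]_d * 'rV[R]_d,
    [/\ 0 < tu.1.1, tu.1.1 < k.+1%:R^-1, `|u - tu.1.2| < k.+1%:R^-1,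
        `|xi - tu.2| < k.+1%:R^-1 & regular_normal (x + tu.1.1 *: tu.1.2) G tu.2].
  move=> k; have [|t [u' [xi' tP]]] := uP k.+1%:R^-1; first by rewrite invr_gt0.
  by exists (t, u', xi').
exists (fun k => (f k).1.1), (fun k => (f k).1.2), (fun k => (f k).2); split.
- split=> [k|]; first by have [] := fP k.
  apply/cvgrPdist_lt => e e0; apply: filterS (harmonic_small e0) => k ke.
  by rewrite sub0r normrN gtr0_norm; have [] := fP k => // ? /lt_trans ->.
- apply/cvgrPdist_lt => e e0; apply: filterS (harmonic_small e0) => k ke.
  by have [_ _ /lt_trans ->] := fP k.
- apply/cvgrPdist_lt => e e0; apply: filterS (harmonic_small e0) => k ke.
  by have [_ _ _ /lt_trans ->] := fP k.
- by move=> k; have [] := fP k.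
Qed.

Lemma limiting_normal_approx x G xi e : limiting_normal x G xi -> 0 < e ->
  exists y xi', [/\ `|x - y| < e, `|xi - xi'| < e & regular_normal y G xi'].
Proof.
move=> [_ [xs [xis [xsx _ xisxi xsG]]]] e0.
have : \forall k \near \oo, `|x - xs k| < e /\ `|xi - xis k| < e.
  by near=> k; split; near: k; [move/cvgrPdist_lt: xsx|move/cvgrPdist_lt: xisxi]; exact.
by move=> /filter_ex[k [? ?]]; exists (xs k), (xis k).
Unshelve. all: by end_near. Qed.

Section OnePolyhedron.
Variables (k : nat) (a : 'I_k -> 'rV[R]_d) (b : 'I_k -> R).

Definition polyhedron : set 'rV[R]_d := [set y | forall j, dotp (a j) y <= b j].

Definition active y : seq 'rV[R]_d := [seq a j | j <- enum 'I_k & dotp (a j) y == b j].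

Lemma activeP y v :
  pcone (active y) v <-> forall j, dotp (a j) y = b j -> dotp (a j) v <= 0.
Proof.
split=> [yv j /eqP ab|yv _ /mapP[j + ->]].
  by apply: yv; apply/mapP; exists j; rewrite // mem_filter ab mem_enum.
by rewrite mem_filter => /andP[/eqP/yv].
Qed.

Lemma dotp_continuous v : continuous (dotp v : 'rV[R]_d -> R).
Proof.
move=> x.
exact: (@cvg_dotp R _ (nbhs x) _ d (fun=> v) id v x (cvg_cst _) cvg_id).
Qed.

Lemma closed_polyhedron : closed polyhedron.
Proof.
have -> : polyhedron = \bigcap_j (dotp (a j) @^-1` [set r | r <= b j]).
  by apply/seteqP; split=> [y yP j _|y yP j]; [exact: yP|exact: (yP j)].
apply: closed_bigI => j _; apply: preimage_closed; last exact: closed_le.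
by move=> x _; exact: dotp_continuous.
Qed.

Lemma step_cvg y v : (y + t *: v) @[t --> 0^'+] --> y.
Proof.
have : (y + t *: v) @[t --> 0^'+] --> y + 0 *: v.
  apply: cvgD; first exact: cvg_cst.
  apply: cvgZr_tmp; apply: cvg_at_right_filter; exact: cvg_id.
by rewrite scale0r addr0.
Qed.

Lemma polyhedron_tangent y z :
  polyhedron y -> polyhedron z -> pcone (active y) (z - y).
Proof. by move=> yP zP; apply/activeP => j ab; rewrite dotpBr ab subr_le0. Qed.

(** Short steps cannot exhaust the slack of the inactive constraints. Together
    with polyhedron_tangent this identifies the cone of the active constraints with
    the tangent cone, and the steps are exact: no correction of v is required. *)
Lemma polyhedron_step y v : polyhedron y -> pcone (active y) v ->
  \forall t \near 0^'+, polyhedron (y + t *: v).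
Proof.
move=> yP /activeP yv; apply: filter_forall => j.
have [ab|nab] := eqVneq (dotp (a j) y) (b j).
  near=> t; rewrite dotpDr dotpZr ab gerDl mulr_ge0_le0 //; last exact: yv.
have slack : 0 < b j - dotp (a j) y by rewrite subr_gt0 lt_neqAle nab yP.
have : dotp (a j) (y + t *: v) @[t --> 0^'+] --> dotp (a j) (y + 0 *: v).
  by apply: cvg_dotp; [exact: cvg_cst|rewrite scale0r addr0; exact: step_cvg].
rewrite scale0r addr0 => /cvgr_le; apply.
by rewrite -subr_gt0.
Unshelve. all: by end_near. Qed.

End OnePolyhedron.
End VariationalCones.

Section PolyhedralUnion.
Variables (R : realType) (d p : nat) (k : 'I_p -> nat).
Variables (a : forall i, 'I_(k i) -> 'rV[R]_d) (b : forall i, 'I_(k i) -> R).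
Implicit Types (x y u v xi : 'rV[R]_d).

Definition polyunion : set 'rV[R]_d := \bigcup_i polyhedron (@a i) (@b i).

Lemma closed_polyunion : closed polyunion.
Proof. by apply: closed_bigcup => [|i _]; [exact: finite_finset|exact: closed_polyhedron]. Qed.

(** Around y the union consists of the pieces that contain y, the others being
    closed, and each of these coincides with its tangent cone at y. Hence only the
    polars of these finitely many polyhedral cones matter. *)
Lemma regular_normal_polyunion y xi : regular_normal y polyunion xi <->
  polyunion y /\
  forall i, polyhedron (@a i) (@b i) y -> polar (pcone (active (@a i) (@b i) y)) xi.
Proof.
split=> [/regular_normalP|] [Py yP]; last apply/regular_normalP; split=> //.
  move=> i yi v yv; apply/ler_addgt0Pl => e e0; rewrite addr0.
  have e'0 : 0 < e / (`|v| + 1) by rewrite divr_gt0 // ltr_wpDl.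
  have ytv : (y + t *: v) @[t --> 0^'+] --> y.
    exact: step_cvg.
  have yte : \forall t \near 0^'+, polyunion (y + t *: v) ->
      dotp xi (y + t *: v - y) <= e / (`|v| + 1) * `|y + t *: v - y|.
    exact: (ytv _ (yP _ e'0)).
  have /filter_ex[t [t0 tP Pt]] : \forall t \near 0^'+,
      [/\ 0 < t, polyunion (y + t *: v) -> dotp xi (t *: v) <= e / (`|v| + 1) * `|t *: v|
        & polyunion (y + t *: v)].
    near=> t; split; near: t; first exact: nbhs_right_gt.
      by apply: filterS yte => t; rewrite (addrC y) addrK.
    by apply: filterS (polyhedron_step yi yv) => t Pt; exists i.
  have := tP Pt; rewrite dotpZr normrZ gtr0_norm // mulrCA ler_pM2l // => /le_trans; apply.
  by rewrite mulrAC ler_pdivrMr ?ltr_wpDl // ler_pM2l // lerDl.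
move=> e e0.
have : \forall z \near y, forall i, ~ polyhedron (@a i) (@b i) y -> ~ polyhedron (@a i) (@b i) z.
  apply: (@filter_forall _ _ _ (nbhs y) (nbhs_filter y)) => i.
  have [yi|nyi] := pselect (polyhedron (@a i) (@b i) y).
    by apply: filterE => z; exact.
  have oi : open (~` polyhedron (@a i) (@b i)) by apply/closed_openC/closed_polyhedron.
  by have := open_nbhs_nbhs (conj oi nyi); apply: filterS.
apply: filterS => z zP [i _ zi].
have yi : polyhedron (@a i) (@b i) y by apply: contrapT => /zP.
apply: le_trans (_ : 0 <= _); last by rewrite mulr_ge0 // ltW.
by apply: (yP _ yi); exact: polyhedron_tangent.
Unshelve. all: by end_near. Qed.

Lemma regular_normal_pcone y : polyunion y ->
  exists s, regular_normal y polyunion = pcone s.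
Proof.
move=> Py.
have /choice[s sP] : forall i, exists s, polar (pcone (active (@a i) (@b i) y)) = pcone s.
  by move=> i; exact: polar_pcone.
exists (flatten [seq s i | i <- [seq i <- enum 'I_p | `[< polyhedron (@a i) (@b i) y >]]]).
apply/seteqP; split=> xi.
  move=> /regular_normal_polyunion[_ yP]; apply/pcone_bigcap => i.
  by rewrite mem_filter => /andP[/asboolP yi _]; rewrite -sP; exact: yP.
move=> /pcone_bigcap yP; apply/regular_normal_polyunion; split=> // i yi.
by rewrite sP; apply: yP; rewrite mem_filter mem_enum andbT; exact/asboolP.
Qed.

End PolyhedralUnion.

(** * Limits along ultrafilters *)

Lemma compact_ball_norm (R : realType) d (z : 'rV[R]_d) (r : R) :
  compact [set x | `|z - x| <= r].
Proof.
apply: bounded_closed_compact; last exact: closed_closed_ball_.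
exists (`|z| + r); split; first exact: num_real.
move=> N N1 x /= zx; apply: ltW; apply: le_lt_trans N1.
by rewrite -[x](subKr z); apply: le_trans (ler_normB _ _) _; rewrite lerD2l.
Qed.

Section UltraLimits.
Context {T : Type} {G : set_system T} {GG : UltraFilter G}.

(** Ultrafilters decide every property, and along them bounded functions
    converge; they take the place of successive extractions of subsequences. *)
Lemma ultra_decide (f : T -> bool) : exists c, \forall z \near G, f z = c.
Proof.
have [Gf|Gf] := in_ultra_setVsetC [set z | f z] GG; first by exists true.
by exists false; apply: filterS Gf => z /negP/negbTE.
Qed.

Lemma ultra_bounded_cvg (R : realType) d (f : T -> 'rV[R]_d) (M : R) :
  (\forall z \near G, `|f z| <= M) -> exists l : 'rV[R]_d, f @ G --> l.
Proof.
move=> fM; pose B := [set x : 'rV[R]_d | `|0 - x| <= M].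
have fB : (f @ G) B by apply: filterS fM => z; rewrite /B /= sub0r normrN.
have [l [_ fl]] : B `&` cluster (f @ G) !=set0.
  by have cB : compact B := @compact_ball_norm R d 0 M; exact: cB.
exists l => V Vl; have [//|GV] := in_ultra_setVsetC (f @^-1` V) GG.
have [x [nVx Vx]] := fl _ _ (GV : (f @ G) (~` V)) Vl.
by case: nVx.
Qed.

(** The regular normal cone at y depends only on which pieces contain y and on
    which constraints are active there. These are finitely many yes-no questions,
    and the ultrafilter settles all of them. *)
Lemma ultra_regular_normal (R : realType) d p (k : 'I_p -> nat)
    (a : forall i, 'I_(k i) -> 'rV[R]_d) (b : forall i, 'I_(k i) -> R)
    (y : T -> 'rV[R]_d) : (\forall z \near G, polyunion a b (y z)) ->
  exists s, \forall z \near G, regular_normal (y z) (polyunion a b) = pcone s.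
Proof.
move=> Py.
have /choice[I0 I0P] i : exists c, \forall z \near G, `[< polyhedron (@a i) (@b i) (y z) >] = c.
  exact: ultra_decide.
have /choice[J0 J0P] (ij : {i : 'I_p & 'I_(k i)}) : exists c,
   \forall z \near G, (dotp (@a (tag ij) (tagged ij)) (y z) == @b (tag ij) (tagged ij)) = c.
  exact: ultra_decide.
have st : \forall z \near G, [/\ polyunion a b (y z),
    forall i, `[< polyhedron (@a i) (@b i) (y z) >] = I0 i &
    forall i j, (dotp (@a i j) (y z) == @b i j) = J0 (Tagged (fun i => 'I_(k i)) j)].
  near=> z; split; near: z => //; first by apply: filter_forall => i; exact: I0P.
  apply: filter_forall => i; apply: filter_forall => j; exact: (J0P (Tagged (fun i => 'I_(k i)) j)).
have /filter_ex[z0 [Pz0 Iz0 Jz0]] := st.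
have [s sE] := regular_normal_pcone Pz0; exists s.
apply: filterS st => z [Pz Iz Jz]; rewrite -sE.
have actE i : active (@a i) (@b i) (y z) = active (@a i) (@b i) (y z0).
  by congr map; apply: eq_filter => j /=; rewrite Jz Jz0.
apply/seteqP; split=> xi /regular_normal_polyunion[_ xiP]; apply/regular_normal_polyunion.
  by split=> // i yi; rewrite -actE; apply: xiP; apply/asboolP; rewrite Iz -Iz0; exact/asboolP.
by split=> // i yi; rewrite actE; apply: xiP; apply/asboolP; rewrite Iz0 -Iz; exact/asboolP.
Unshelve. all: by end_near. Qed.

End UltraLimits.

(** * Multipliers under metric regularity *)

Section FirstOrder.
Variables (R : realType) (n m : nat).
Implicit Types (f : 'rV[R]_n -> 'rV[R]_m) (x h : 'rV[R]_n).

Lemma differentiable_expansion f x e : differentiable f x -> 0 < e ->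
  \forall y \near x, `|f y - f x - (y - x) *m 'J f x| <= e * `|y - x|.
Proof.
move=> /diff_locallyP[_ fE] e0.
have /eqaddoP/(_ _ e0) fe := fE.
rewrite (near_shift 0 x) subr0; apply: filterS fe => h /=.
rewrite addrK /jacobian mul_rV_lin1.
by rewrite -[(_ - _) h]/(f (h + x) - (f x + 'd f x h)) opprD addrA.
Qed.

Lemma differentiable_ray f x h : differentiable f x ->
  t^-1 *: (f (x + t *: h) - f x) @[t --> 0^'+] --> h *m 'J f x.
Proof.
move=> fx; rewrite -deriveEjacobian //; apply: cvg_dnbhs_at_right.
have dfx : derivable f x h by exact: diff_derivable.
have : t^-1 *: ((f \o shift x) (t *: h) - f x) @[t --> 0^'] --> 'D_h f x by exact: dfx.
by under eq_fun do rewrite /= [_ *: h + x]addrC.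
Qed.

End FirstOrder.

Lemma near_dist_lt (R : realType) d (a z : 'rV[R]_d) (r : R) :
  `|a - z| < r -> \forall p \near z, `|a - p| < r.
Proof.
rewrite -subr_gt0 => r0; have := @nbhs_ball_norm _ _ z (PosNum r0).
apply: filterS => p /=; have := ler_distD z a p; lra.
Qed.

Lemma norm_trmx (R : realType) m n (A : 'M[R]_(m, n)) : `|A^T| = `|A|.
Proof.
apply/eqP; rewrite eq_le; apply/andP; split; apply: norm_le_coord => // i j.
  by rewrite mxE coord_le_norm.
by have := coord_le_norm A^T j i; rewrite mxE.
Qed.

Section Penalisation.
Variables (R : realType) (n m : nat).

(** Expanding the square shows that (z - y).(p - y) is at most |p - y|^2 / 2
    for p in P: proximal normals are regular normals. *)
Lemma regular_normal_nearest (P : set 'rV[R]_m) (z y : 'rV[R]_m) (k : R) :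
  0 <= k -> P y ->
  (\forall p \near y, P p -> dotp (z - y) (z - y) <= dotp (z - p) (z - p)) ->
  regular_normal y P (k *: (z - y)).
Proof.
move=> k0 Py ymin; apply/regular_normalP; split=> // e e0.
have e'0 : 0 < e / (k * m%:R + 1) by rewrite divr_gt0 // ltr_wpDl // mulr_ge0.
near=> p => Pp; have : dotp (z - y) (z - y) <= dotp (z - p) (z - p).
  by move: Pp; near: p; exact: ymin.
have py : `|y - p| < e / (k * m%:R + 1).
  by near: p; exact: (@nbhs_ball_norm _ _ y (PosNum e'0)).
have -> : z - p = (z - y) - (p - y) by rewrite opprB addrA subrK.
rewrite distrC in py; move: py.
move: (p - y) (z - y) => w v py; rewrite !dotpBl !dotpBr (dotpC w v) => dw.
have {}py : (k * m%:R + 1) * `|w| <= e.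
  by rewrite mulrC -ler_pdivlMr ?ltr_wpDl ?mulr_ge0 // ltW.
have := dotp_le w w; rewrite dotpZl => ww.
have {}dw : k * dotp v w <= k * (m%:R * `|w| * `|w|).
  by apply: ler_wpM2l => //; have := dotp_ge0 w; lra.
apply: le_trans dw _; have := normr_ge0 w; nra.
Unshelve. all: by end_near. Qed.

(** The directional derivatives of obj at a local minimiser are nonnegative, and
    the nonsmooth term contributes at most eta |h| to the one in direction h.
    Testing with the unit vectors of both signs bounds the gradient of the smooth
    part. *)
Lemma penalised_stationarity (q : 'rV[R]_n -> 'rV[R]_m) (x0 x xi : 'rV[R]_n)
    (y : 'rV[R]_m) (eta k : R) : differentiable q x -> 0 <= eta ->
  let obj x' := - dotp xi (x' - x0) + eta * `|x' - x0|
                + k / 2 * dotp (q x' - y) (q x' - y) in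
  (\forall x' \near x, obj x <= obj x') ->
  `|(k *: (q x - y)) *m ('J q x)^T - xi| <= eta.
Proof.
move=> qx eta0 obj xmin.
have main h : dotp xi h <= eta * `|h| + dotp (k *: (q x - y)) (h *m 'J q x).
  pose D t := t^-1 *: (q (x + t *: h) - q x).
  have Dlim : D t @[t --> 0^'+] --> h *m 'J q x by exact: differentiable_ray.
  have tlim : t @[t --> (0 : R)^'+] --> (0 : R).
    by apply: cvg_at_right_filter; exact: cvg_id.
  have : (eta * `|h| + k / 2 * (2 * dotp (q x - y) (D t) + t * dotp (D t) (D t)))
      @[t --> 0^'+] --> eta * `|h| + k / 2 * (2 * dotp (q x - y) (h *m 'J q x) +
         0 * dotp (h *m 'J q x) (h *m 'J q x)).
    apply: cvgD; first exact: cvg_cst.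
    apply: cvgM; first exact: cvg_cst.
    apply: cvgD; last by apply: cvgM => //; exact: cvg_dotp.
    by apply: cvgM; [exact: cvg_cst|apply: cvg_dotp => //; exact: cvg_cst].
  have -> : eta * `|h| + k / 2 * (2 * dotp (q x - y) (h *m 'J q x) +
         0 * dotp (h *m 'J q x) (h *m 'J q x)) =
       eta * `|h| + dotp (k *: (q x - y)) (h *m 'J q x) by rewrite dotpZl; field.
  move/cvgr_to_ge; apply.
  have xtmin : \forall t \near 0^'+, obj x <= obj (x + t *: h) by exact: (@step_cvg _ _ x h _ xmin).
  near=> t; have t0 : 0 < t by near: t; exact: nbhs_right_gt.
  have : obj x <= obj (x + t *: h) by near: t.
  have qE : q (x + t *: h) = q x + t *: D t.
    by rewrite /D scalerA mulfV ?gt_eqF // scale1r [RHS]addrC subrK.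
  rewrite /obj qE.
  have -> : q x + t *: D t - y = (q x - y) + t *: D t by rewrite addrAC.
  have -> : x + t *: h - x0 = (x - x0) + t *: h by rewrite addrAC.
  have := ler_normD (x - x0) (t *: h).
  rewrite normrZ gtr0_norm // => nD.
  have : eta * `|x - x0 + t *: h| <= eta * `|x - x0| + eta * (t * `|h|).
    by rewrite -mulrDr ler_wpM2l.
  move: (q x - y) (D t) (x - x0) => v d0 dx.
  rewrite !dotpDr !dotpDl !dotpZl !dotpZr (dotpC d0 v) => nD' le.
  rewrite -(@ler_pM2l _ t) //; lra.
apply: norm_le_coord => // i j; rewrite ord1 ler_norml.
have e1 : `|delta_mx 0 j : 'rV[R]_n| <= 1.
  by apply: norm_le_coord => // i' j'; rewrite mxE; case: (_ && _); rewrite ?normr1 ?normr0.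
have e2 : eta * `|delta_mx 0 j : 'rV[R]_n| <= eta by rewrite ler_piMr.
set w := k *: (q x - y) in main *.
have wE : dotp w (delta_mx 0 j *m 'J q x) = (w *m ('J q x)^T) 0 j.
  by rewrite dotpC dotp_mulmx dotpC dotp_delta.
have -> : (w *m ('J q x)^T - xi) 0 j = (w *m ('J q x)^T) 0 j - xi 0 j.
  by move: (w *m _) => W; rewrite !mxE.
have := main (delta_mx 0 j); have := main (- delta_mx 0 j).
rewrite normrN mulNmx !dotpNr wE dotp_delta; lra.
Unshelve. all: by end_near. Qed.

End Penalisation.

Section MetricRegularity.
Variables (R : realType) (n m : nat) (q : 'rV[R]_n -> 'rV[R]_m) (P : set 'rV[R]_m).
Variables (x0 : 'rV[R]_n) (kappa : R).
Hypothesis kappa_gt0 : 0 < kappa.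
Hypothesis MR : metrically_regular (fun x : 'rV[R]_n => [set q x - y | y in P]) kappa x0 0.

Let c := kappa * m.+1%:R.

(** Metric regularity in the sup norm: c absorbs the change of norm, and the
    slack e stands for a distance that is possibly not attained. *)
Lemma metrically_regular_norm : exists2 r, 0 < r & forall x y p e,
  `|x0 - x| < r -> `|y| < r -> P p -> 0 < e ->
  exists2 x', P (q x' - y) & `|x - x'| <= c * `|y - (q x - p)| + e.
Proof.
case: MR => _ [U [V [/nbhs_normP[r1 /= r10 Ur] /nbhs_normP[r2 /= r20 Vr] UV]]].
exists (Num.min r1 r2); first by rewrite lt_min r10.
move=> x y p e; rewrite !lt_min => /andP[xr _] /andP[_ yr] Pp e0.
have Mlt : (edist_set x [set x' | [set (q x' - y0)%R | y0 in P] y] <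
    (c * `|y - (q x - p)| + e)%:E)%E.
  apply: le_lt_trans (UV _ _ (Ur _ xr) (Vr _ _)) _.
    by rewrite /= sub0r normrN.
  apply: (@le_lt_trans _ _ (kappa%:E * (enorm (y - (q x - p)))%:E)%E).
    apply: lee_wpmul2l; first by rewrite lee_fin ltW.
    by apply: ereal_inf_lbound; exists (q x - p) => //; exists p.
  rewrite -EFinM lte_fin; apply: le_lt_trans (_ : c * `|y - (q x - p)| < _).
    by rewrite -mulrA ler_pM2l // enorm_le_norm.
  by rewrite ltrDl.
have /ereal_inf_lt[_ [x' [p' Pp' <-] <-]] := Mlt.
rewrite lte_fin => xx'; exists x'; first by rewrite subKr.
exact: le_trans (norm_le_enorm _) (ltW xx').
Qed.

Hypothesis q_diff0 : differentiable q x0.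

(** If the inclusion q x in P is perturbed by s lam, regularity restores it by a
    displacement dx of x with |dx| at most c s |lam|. This produces a point z of P
    with z - y = dx A + s lam + o(s), and lam.(z - y) <= o(s) because lam is a
    regular normal. Therefore s |lam|^2 is at most - dx.(lam A^T) + o(s), which is
    bounded by n c s |lam| |lam A^T| + o(s). *)
Lemma multiplier_bound : exists2 r, 0 < r & forall y lam,
  `|q x0 - y| < r -> regular_normal y P lam ->
  `|lam| <= n%:R * c * `|lam *m ('J q x0)^T|.
Proof.
have c0 : 0 < c by rewrite mulr_gt0.
have [r r0 rP] := metrically_regular_norm; exists r => // y lam yr.
move=> /regular_normalP[Py lamP].
set A := 'J q x0.
have [->|lam0] := eqVneq lam 0; first by rewrite normr0 !mulr_ge0 // ltW.
rewrite -(@ler_pM2l _ `|lam|) ?normr_gt0 // -expr2.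
apply/ler_addgt0Pr => e' e'0.
(* M and M2 bound the displacements of x and of the point of P divided by s,
   and B collects the coefficients of the error terms *)
pose M := c * `|lam| + 1.
pose M2 := n%:R * M * `|A| + M + `|lam|.
pose B := n%:R * `|lam *m A^T| + m%:R * `|lam| * M + M2 + 1.
have M0 : 0 < M by rewrite ltr_wpDl // mulr_ge0 // ltW.
have M20 : 0 <= M2 by rewrite !addr_ge0 // ?mulr_ge0 // ltW.
have B0 : 0 < B by rewrite ltr_wpDl // !addr_ge0 // ?mulr_ge0 // ltW.
pose e := Num.min 1 (e' / B).
have e0 : 0 < e by rewrite lt_min ltr01 divr_gt0.
have e1 : e <= 1 by rewrite ge_min lexx.
have eB : e * B <= e' by rewrite -ler_pdivlMr // ge_min lexx orbT.
have := differentiable_expansion q_diff0 e0 => /nbhs_normP[r1 /= r10 qr1].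
have /nbhs_normP[r2 /= r20 lamr2] := lamP _ e0.
have [s [s0 se sM sM2 slam]] : exists s, [/\ 0 < s, s <= e, s * M < r1, s * M2 < r2 &
   `|q x0 - y| + s * `|lam| < r].
  near (0 : R)^'+ => s; exists s; split.
  - by near: s; exact: nbhs_right_gt.
  - by near: s; exact: nbhs_right_le.
  - by rewrite -ltr_pdivlMr //; near: s; apply: nbhs_right_lt; rewrite divr_gt0.
  - apply: (@le_lt_trans _ _ (s * (M2 + 1))).
      by rewrite ler_wpM2l ?lerDl //; near: s; exact: nbhs_right_ge.
    by rewrite -ltr_pdivlMr ?ltr_wpDl //; near: s; apply: nbhs_right_lt; rewrite divr_gt0 // ltr_wpDl.
  - rewrite addrC -ltrBrDr -ltr_pdivlMr ?normr_gt0 //; near: s; apply: nbhs_right_lt.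
    by rewrite divr_gt0 ?normr_gt0 // subr_gt0.
have := rP x0 (q x0 - y - s *: lam) y (s ^+ 2).
rewrite subrr normr0 => /(_ r0) [|||xs].
- apply: le_lt_trans slam; apply: le_trans (ler_normB _ _) _.
  by rewrite normrZ gtr0_norm.
- exact: Py.
- by rewrite exprn_gt0.
set z := q xs - (q x0 - y - s *: lam).
set dx := xs - x0; set rm := q xs - q x0 - dx *m A => Pz.
have zyE : z - y = dx *m A + rm + s *: lam.
  rewrite /rm /z; move: (dx *m A) (q xs) (q x0) => v1 v2 v3.
  by apply/rowP => i; rewrite !mxE; ring.
have -> : q x0 - y - s *: lam - (q x0 - y) = - (s *: lam) by rewrite addrAC subrr sub0r.
rewrite normrN normrZ gtr0_norm // distrC -/dx => dxs.
have {}dxs : `|dx| <= s * (c * `|lam| + s) by apply: le_trans dxs _; nra.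
have dxe : `|dx| <= s * (c * `|lam| + e).
  by apply: le_trans dxs _; rewrite ler_pM2l // lerD2l.
have dxM : `|dx| <= s * M.
  by apply: le_trans dxe _; rewrite ler_pM2l // lerD2l.
have rmM : `|rm| <= e * (s * M).
  apply: le_trans (_ : e * `|dx| <= _); last by rewrite ler_pM2l.
  by apply: qr1; rewrite /= distrC -/dx; exact: le_lt_trans dxM sM.
have zyM : `|z - y| <= s * M2.
  rewrite zyE; apply: le_trans (ler_normD _ _) _; rewrite normrZ gtr0_norm //.
  have -> : s * M2 = n%:R * (s * M) * `|A| + s * M + s * `|lam| by rewrite /M2; ring.
  rewrite lerD2r; apply: le_trans (ler_normD _ _) _; apply: lerD.
    by apply: le_trans (norm_mulmx_le _ _) _; rewrite ler_wpM2r // ler_wpM2l.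
  by apply: le_trans rmM _; rewrite ler_piMl // mulr_ge0 // ltW.
have lamz : dotp lam (z - y) <= e * (s * M2).
  apply: le_trans (_ : e * `|z - y| <= _); last by rewrite ler_pM2l.
  by apply: lamr2 => //=; rewrite distrC; exact: le_lt_trans zyM sM2.
have dotA : - dotp lam (dx *m A) <= n%:R * (s * (c * `|lam| + e)) * `|lam *m A^T|.
  rewrite dotpC dotp_mulmx -dotpNl; apply: le_trans (dotp_le _ _) _; rewrite normrN.
  by rewrite ler_wpM2r // ler_wpM2l.
have dotrm : - dotp lam rm <= m%:R * `|lam| * (e * (s * M)).
  by rewrite -dotpNr; apply: le_trans (dotp_le _ _) _; rewrite normrN ler_wpM2l // mulr_ge0.
have sq := sqr_norm_le_dotp lam.
clearbody rm; move: lamz; rewrite zyE !dotpDr dotpZr => lamz.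
have : s * `|lam| ^+ 2 <= s * (`|lam| * (n%:R * c * `|lam *m A^T|) + e * B).
  have : s * `|lam| ^+ 2 <= s * dotp lam lam by rewrite ler_pM2l.
  have : 0 <= s * e by rewrite mulr_ge0 // ltW.
  rewrite /B; move: lamz dotA dotrm; lra.
by rewrite ler_pM2l // => /le_trans; apply; rewrite lerD2l.
Unshelve. all: by end_near. Qed.

(** The inequality that defines regular normals holds at the feasible point x'
    that regularity provides at distance about c |q x - p| from x; passing from x'
    back to x costs a multiple of this distance. *)
Lemma regular_normal_penalty xi eta : regular_normal x0 (q @^-1` P) xi ->
  0 < eta -> eta <= 1 ->
  exists2 r, 0 < r & forall x p, `|x0 - x| < r -> P p -> `|q x - p| < r ->
    dotp xi (x - x0) <= eta * `|x - x0| + (n%:R * `|xi| + 1) * c * `|q x - p|.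
Proof.
move=> /regular_normalP[_ xiP] eta0 eta1.
have c0 : 0 < c by rewrite mulr_gt0.
have /nbhs_normP[r1 /= r10 xir] := xiP _ eta0.
have [r2 r20 rP] := metrically_regular_norm.
have r'0 : 0 < r1 / (2 + c) by rewrite divr_gt0 // ltr_wpDr // ltW.
exists (Num.min r2 (r1 / (2 + c))); first by rewrite lt_min r20.
move=> x p; rewrite !lt_min !ltr_pdivlMr ?ltr_wpDr ?(ltW c0) //.
move=> /andP[xr2 xr1] Pp /andP[_ qpr].
apply/ler_addgt0Pr => e e0.
(* a slack that keeps x' in the ball of radius r1 and costs at most e *)
pose e' := Num.min (e / (n%:R * `|xi| + 1)) (r1 / (2 + c)).
have nxi0 : 0 < n%:R * `|xi| + 1 by rewrite ltr_wpDl // mulr_ge0.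
have e'0 : 0 < e' by rewrite lt_min r'0 divr_gt0.
have [e'e e'r] : (n%:R * `|xi| + 1) * e' <= e /\ e' * (2 + c) <= r1.
  split; first by rewrite mulrC -ler_pdivlMr // ge_min lexx.
  by rewrite -ler_pdivlMr ?ltr_wpDr ?(ltW c0) // ge_min lexx orbT.
have [|x'] := rP x 0 p e' xr2 _ Pp e'0; first by rewrite normr0.
rewrite subr0 sub0r normrN => Px' xx'.
have x'r : `|x0 - x'| < r1.
  have := ler_distD x x0 x'; have := normr_ge0 (x0 - x); have := normr_ge0 (q x - p).
  nra.
have x'le := xir _ x'r Px'.
have -> : x - x0 = (x - x') + (x' - x0) by rewrite addrA subrK.
rewrite dotpDr; have d1 := dotp_le xi (x - x').
have : eta * `|x' - x0| <= eta * `|x - x0| + `|x - x'|.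
  have := ler_distD x x' x0; rewrite (distrC x' x).
  have := normr_ge0 (x - x'); nra.
have -> : x - x' + (x' - x0) = x - x0 by rewrite addrA subrK.
have : (n%:R * `|xi| + 1) * `|x - x'| <= (n%:R * `|xi| + 1) * (c * `|q x - p| + e').
  by rewrite ler_pM2l.
lra.
Qed.


Hypothesis q_cont : continuous q.
Hypothesis q_diff : \forall x \near x0, differentiable q x.
Hypothesis Jq_cont : {for x0, continuous (fun x => 'J q x)}.
Hypothesis P_closed : closed P.

(** Minimise - xi.(x - x0) + 2 eta |x - x0| + (k / 2) |q x - y|^2 over x near x0
    and y in P near q x0. By regular_normal_penalty the residual s = |q x - y| at a
    minimiser satisfies k s <= 2 C, so that lam = k (q x - y) is bounded, and for
    large k the minimiser is as close to (x0, q x0) as desired. Optimality in y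
    makes lam a regular normal to P, and optimality in x gives lam A^T = xi up to
    2 eta and up to the variation of the Jacobian near x0. *)
Lemma regular_normal_preimage_multiplier xi e :
  regular_normal x0 (q @^-1` P) xi -> 0 < e ->
  exists y lam, [/\ regular_normal y P lam, `|q x0 - y| < e,
    `|lam *m ('J q x0)^T - xi| <= e & `|lam| <= 2 * ((n%:R * `|xi| + 1) * c)].
Proof.
move=> xiN e0.
have Pq0 : P (q x0) by case: xiN.
have c0 : 0 < c by rewrite mulr_gt0.
pose C := (n%:R * `|xi| + 1) * c.
have C0 : 0 < C by rewrite mulr_gt0 // ltr_wpDl // mulr_ge0.
pose eta := Num.min 1 (e / 4).
have eta0 : 0 < eta by rewrite lt_min ltr01 divr_gt0.
have [eta1 etae] : eta <= 1 /\ eta <= e / 4 by rewrite !ge_min !lexx orbT.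
have [r r0 rP] := regular_normal_penalty xiN eta0 eta1.
pose b := Num.min r e / 4.
have b0 : 0 < b by rewrite divr_gt0 // lt_min r0.
have [br be] : b <= r / 4 /\ b <= e / 4.
  by rewrite /b !ler_pM2r // !ge_min !lexx orbT.
(* the variation of the Jacobian is multiplied by m |lam| <= 2 m C *)
pose e' := e / (4 * (m%:R * C + 1)).
have mC0 : 0 < m%:R * C + 1 by rewrite ltr_wpDl // mulr_ge0 // ltW.
have e'0 : 0 < e' by rewrite divr_gt0 // mulr_gt0.
have [rho [rho0 rhor near_x0]] : exists rho, [/\ 0 < rho, rho < r &
   forall x, `|x0 - x| <= rho -> [/\ `|q x0 - q x| < b, differentiable q x
      & `|'J q x0 - 'J q x| < e']].
  have : \forall x \near x0, [/\ `|q x0 - q x| < b, differentiable q x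
      & `|'J q x0 - 'J q x| < e'].
    have qc : q x @[x --> x0] --> q x0 by exact: q_cont.
    have Jc : 'J q x @[x --> x0] --> 'J q x0 by exact: Jq_cont.
    near=> x; split; near: x => //; first by move/cvgrPdist_lt : qc; exact.
    by move/cvgrPdist_lt : Jc; exact.
  move=> /nbhs_normP[r1 /= r10 r1P].
  exists (Num.min r r1 / 2); split.
  - by rewrite divr_gt0 // lt_min r0.
  - by apply: le_lt_trans (_ : r / 2 < _); [rewrite ler_pM2r // ge_min lexx|lra].
  - move=> x xr; apply: r1P => /=; apply: le_lt_trans xr _.
    by apply: le_lt_trans (_ : r1 / 2 < _); [rewrite ler_pM2r // ge_min lexx orbT|lra].
(* the weight of the penalty, large enough to localise the minimiser *)
pose k := 2 * C / b + 2 * C * C / (eta * rho) + 1.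
have p1 : 0 < 2 * C / b by rewrite divr_gt0 // mulr_gt0.
have p2 : 0 < 2 * C * C / (eta * rho) by rewrite divr_gt0 ?mulr_gt0.
have k0 : 0 < k by rewrite /k; lra.
have [kb krho] : 2 * C < k * b /\ 2 * C * C < k * (eta * rho).
  split; [rewrite -ltr_pdivrMr //|rewrite -ltr_pdivrMr; last exact: mulr_gt0];
    rewrite /k; lra.
pose K1 := [set x : 'rV[R]_n | `|x0 - x| <= rho].
pose K2 := P `&` [set y : 'rV[R]_m | `|q x0 - y| <= r / 2].
pose obj (z : 'rV[R]_n * 'rV[R]_m) := - dotp xi (z.1 - x0) + (2 * eta) * `|z.1 - x0|
                + k / 2 * dotp (q z.1 - z.2) (q z.1 - z.2).
have K1c : compact K1 by exact: compact_ball_norm.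
have K2c : compact K2.
  apply: subclosed_compact (@compact_ball_norm _ _ (q x0) (r / 2)) _; last by move=> y [].
  apply: closedI => //; exact: compact_closed (@compact_ball_norm _ _ (q x0) (r / 2)).
have objc : continuous obj.
  move=> z.
  have z1 : (fun z' : 'rV[R]_n * 'rV[R]_m => z'.1) @ z --> z.1 by exact: cvg_fst.
  have z2 : (fun z' : 'rV[R]_n * 'rV[R]_m => z'.2) @ z --> z.2 by exact: cvg_snd.
  have qz : (fun z' : 'rV[R]_n * 'rV[R]_m => q z'.1) @ z --> q z.1.
    by apply: cvg_comp z1 _; exact: q_cont.
  have z1x0 : (fun z' : 'rV[R]_n * 'rV[R]_m => z'.1 - x0) @ z --> z.1 - x0.
    by apply: cvgB => //; exact: cvg_cst.
  apply: cvgD; first apply: cvgD.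
  - by apply: cvgN; apply: cvg_dotp => //; exact: cvg_cst.
  - by apply: cvgM; [exact: cvg_cst|exact: cvg_norm].
  - by apply: cvgM; [exact: cvg_cst|apply: cvg_dotp; exact: cvgB].
have K0 : (K1 `*` K2) (x0, q x0).
  have r20 : 0 <= r / 2 by rewrite divr_ge0 // ltW.
  by split; rewrite /K1 /K2 /= ?subrr ?normr0; [exact: ltW|split].
have [||[x y] /set_mem[/= Kx [Py Ky]] xymin] := @compact_EVT_min _ _ obj (K1 `*` K2) _ (compact_setX K1c K2c).
- by exists (x0, q x0).
- exact: continuous_subspaceT.
have xyobj x' y' : `|x0 - x'| <= rho -> P y' -> `|q x0 - y'| <= r / 2 -> obj (x, y) <= obj (x', y').
  by move=> *; apply: xymin; apply/mem_set.
have [qxb qx Jx] := near_x0 x Kx.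
set s := `|q x - y|.
have s0 : 0 <= s by exact: normr_ge0.
have {}Kx : `|x0 - x| <= rho by exact: Kx.
have {}Ky : `|q x0 - y| <= r / 2 by exact: Ky.
have sr : s < r.
  by have := ler_distD (q x0) (q x) y; rewrite (distrC (q x) (q x0)) -/s; lra.
have := rP x y (le_lt_trans Kx rhor) Py sr; rewrite -/C -/s => pen.
have obj0 : obj (x, y) <= 0.
  have o0 : obj (x0, q x0) = 0 by rewrite /obj /= !subrr normr0 !dotp0r !mulr0 oppr0 !addr0.
  by rewrite -o0; case: K0 => /= h1 [_ h2]; exact: xyobj.
have kh : 0 < k / 2 by rewrite divr_gt0.
have est : eta * `|x - x0| + k / 2 * s ^+ 2 <= C * s.
  have : k / 2 * s ^+ 2 <= k / 2 * dotp (q x - y) (q x - y).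
    by rewrite ler_pM2l //; exact: sqr_norm_le_dotp.
  move: obj0; rewrite /obj /=; lra.
have ks : k * s <= 2 * C.
  have [s00|s0'] := leP s 0; first by apply: le_trans (_ : 0 <= _); nra.
  rewrite -(@ler_pM2r _ s) //; have := mulr_ge0 (ltW eta0) (normr_ge0 (x - x0)); lra.
have sb : s < b by rewrite -(@ltr_pM2l _ k) //; lra.
have xrho : `|x - x0| < rho.
  rewrite -(@ltr_pM2l _ (k * eta)) ?mulr_gt0 //.
  have : k * (eta * `|x - x0|) <= C * (k * s).
    by rewrite [leRHS]mulrCA ler_pM2l //; have := mulr_ge0 (ltW kh) (sqr_ge0 s); lra.
  have : C * (k * s) <= C * (2 * C) by rewrite ler_pM2l.
  lra.
have qy : `|q x0 - y| < b + b.
  by apply: le_lt_trans (ler_distD (q x) _ _) _; rewrite ltrD.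
exists y, (k *: (q x - y)); split.
- apply: regular_normal_nearest => //; first exact: ltW.
  have : \forall p \near y, `|q x0 - p| < r / 2.
    by apply: near_dist_lt; lra.
  apply: filterS => p pr Pp; have := xyobj x p Kx Pp (ltW pr).
  by rewrite /obj /= lerD2l ler_pM2l.
- lra.
- have : `|k *: (q x - y) *m ('J q x)^T - xi| <= 2 * eta.
    apply: (@penalised_stationarity _ _ _ _ x0) => //; first by rewrite mulr_ge0 // ltW.
    have : \forall x' \near x, `|x' - x0| < rho.
      have : \forall x' \near x, `|x0 - x'| < rho by apply: near_dist_lt; rewrite distrC.
      by apply: filterS => x'; rewrite distrC.
    apply: filterS => x' x'r; have := xyobj x' y _ Py _; rewrite /obj /=; apply; last lra.
    by rewrite distrC ltW.
  have kl : `|k *: (q x - y)| <= 2 * C by rewrite normrZ gtr0_norm.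
  move: Jx kl; move: ('J q x0) ('J q x) (k *: (q x - y)) => A0 A w Jx kl wA.
  have -> : w *m A0^T - xi = (w *m A^T - xi) + w *m (A0 - A)^T.
    by rewrite linearB /= mulmxBr addrAC addrCA subrr addr0.
  have : `|w *m (A0 - A)^T| <= e / 2.
    apply: le_trans (norm_mulmx_le _ _) _; rewrite norm_trmx.
    apply: (@le_trans _ _ (m%:R * (2 * C) * e')).
      by apply: ler_pM; rewrite ?mulr_ge0 // ?ler_wpM2l //; exact: ltW.
    have : (m%:R * C + 1) * e' = e / 4 by rewrite /e'; field; rewrite gt_eqF.
    lra.
  have := ler_normD (w *m A^T - xi) (w *m (A0 - A)^T); lra.
- by rewrite normrZ gtr0_norm.
Unshelve. all: by end_near. Qed.

End MetricRegularity.

(** * Differentials of gradients and Taylor estimates *)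

Section NearEqual.
Variables (R : realType) (V W : normedModType R).

(** Gradients are given by a matrix formula only at points of differentiability,
    hence only near the point at which they are differentiated again. *)
Lemma near_eq_diff (f g : V -> W) x : (\forall y \near x, f y = g y) ->
  differentiable f x -> differentiable g x /\ 'd g x = 'd f x :> (V -> W).
Proof.
move=> fg fx; have [df fE] := (diff_locallyP _ _).1 fx.
have gE : g \o shift x = cst (g x) + 'd f x +o_ 0 id.
  apply/eqaddoP => e e0; have /eqaddoP/(_ _ e0) := fE.
  have fgx : f x = g x by exact: nbhs_singleton fg.
  have : \forall h \near 0, f (h + x) = g (h + x).
    by move: fg; rewrite (near_shift 0 x) subr0.
  apply: filterS2 => h /= fgh.
  by rewrite -[(_ - _) h]/(f (h + x) - (f x + 'd f x h)) fgh fgx.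
have dgE : 'd g x = 'd f x :> (V -> W) by exact: diff_unique.
split; last exact: dgE.
by apply/diff_locallyP; rewrite dgE; split; [exact: df|exact: gE].
Qed.

End NearEqual.

Section LinearPrecomposition.
Variables (R : realType) (n m : nat).
Implicit Types (lam : 'rV[R]_m).

(** A named function with values in R^o, able to carry a linear structure. *)
Definition dotp_with lam : 'rV[R]_m -> R^o := dotp lam.

Fact dotp_with_linear lam : linear (dotp_with lam).
Proof. by move=> c u v; rewrite /dotp_with dotpDr dotpZr. Qed.

HB.instance Definition _ lam :=
  GRing.isLinear.Build R 'rV[R]_m R^o *:%R (dotp_with lam) (dotp_with_linear lam).

Definition mul_tr lam (M : 'M[R]_(n, m)) : 'rV[R]_n := lam *m M^T.

Fact mul_tr_linear lam : linear (mul_tr lam).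
Proof. by move=> c u v; rewrite /mul_tr linearP /= mulmxDr scalemxAr. Qed.

HB.instance Definition _ lam :=
  GRing.isLinear.Build R 'M[R]_(n, m) 'rV[R]_n *:%R (mul_tr lam) (mul_tr_linear lam).

Lemma mul_tr_continuous lam : continuous (mul_tr lam).
Proof.
move=> M; apply: (@cvg_mulmx _ _ (nbhs M) _ _ _ _ (fun=> lam) (@trmx _ _ _)).
  exact: cvg_cst.
exact: (@cvg_trmx _ _ (nbhs M) _ _ _ id M cvg_id).
Qed.

Lemma diff_dotp (V : normedModType R) (f : V -> 'rV[R]_m) lam x :
  differentiable f x ->
  differentiable (fun y => dotp lam (f y)) x /\
  forall h, 'd (fun y => dotp lam (f y)) x h = dotp lam ('d f x h).
Proof.
move=> fx; have lx : differentiable (dotp_with lam) (f x).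
  by apply: linear_differentiable; exact: dotp_continuous.
have -> : (fun y => dotp lam (f y)) = dotp_with lam \o f by [].
split; first exact: differentiable_comp.
move=> h; rewrite diff_comp // diff_lin //; exact: dotp_continuous.
Qed.

Lemma diff_mul_tr (V : normedModType R) (f : V -> 'M[R]_(n, m)) lam x :
  differentiable f x ->
  differentiable (fun y => lam *m (f y)^T) x /\
  forall h, 'd (fun y => lam *m (f y)^T) x h = lam *m ('d f x h)^T.
Proof.
move=> fx; have lx : differentiable (mul_tr lam) (f x).
  by apply: linear_differentiable; exact: mul_tr_continuous.
have -> : (fun y => lam *m (f y)^T) = mul_tr lam \o f by [].
split; first exact: differentiable_comp.
move=> h; rewrite diff_comp // diff_lin //; exact: mul_tr_continuous.
Qed.

End LinearPrecomposition.

Section Hessians.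
Variables (R : realType) (n m : nat) (q : 'rV[R]_n -> 'rV[R]_m).
Implicit Types (x z h : 'rV[R]_n) (lam : 'rV[R]_m).

Lemma gradient_dotp lam x : differentiable q x ->
  gradient (fun x => dotp lam (q x)) x = lam *m ('J q x)^T.
Proof.
move=> qx; apply/rowP => j; rewrite mxE (diff_dotp lam qx).2.
by rewrite -mul_rV_lin1 -/('J q x) dotpC dotp_mulmx dotpC dotp_delta.
Qed.

Variable z : 'rV[R]_n.
Hypothesis q_diff : \forall x \near z, differentiable q x.
Hypothesis Jq_diff : differentiable (fun x => 'J q x) z.

(** The gradient of lam.q is lam (J q)^T, and h *m hessian is its derivative in
    direction h; so every Hessian is read off from the differential of J q. *)
Lemma mulmx_hessian_dotp lam h :
  h *m hessian (fun x => dotp lam (q x)) z = lam *m ('d (fun x => 'J q x) z h)^T.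
Proof.
have [Jd JE] := diff_mul_tr lam Jq_diff.
have JN : \forall x \near z, lam *m ('J q x)^T = gradient (fun x => dotp lam (q x)) x.
  by apply: filterS q_diff => x /gradient_dotp.
have [_ gE] := near_eq_diff JN Jd.
by rewrite /hessian /jacobian mul_rV_lin1 gE JE.
Qed.

Lemma mulmx_hessian_coord i h :
  h *m hessian (fun x => q x 0 i) z = row i ('d (fun x => 'J q x) z h)^T.
Proof.
have -> : (fun x => q x 0 i) = (fun x => dotp (delta_mx 0 i) (q x)).
  by apply/funext => x; rewrite dotpC dotp_delta.
by rewrite mulmx_hessian_dotp rowE.
Qed.

Lemma mulmx_hessian_dotpE lam h : h *m hessian (fun x => dotp lam (q x)) z =
  \sum_i lam 0 i *: (h *m hessian (fun x => q x 0 i) z).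
Proof.
rewrite [LHS]mulmx_hessian_dotp mulmx_sum_row; apply: eq_bigr => i _.
by congr (_ *: _); exact/esym/mulmx_hessian_coord.
Qed.

Lemma hess_form_dotp lam h : hess_form (fun x => dotp lam (q x)) z h =
  dotp lam (\row_i hess_form (fun x => q x 0 i) z h).
Proof.
rewrite /hess_form [in LHS]mulmx_hessian_dotpE [RHS]dotpE /dotp mulmx_suml summxE.
by apply: eq_bigr => i _; rewrite -scalemxAl !mxE.
Qed.

End Hessians.

Section MeanValue.
Variable R : realType.

Lemma mean_value_bound (f df : R -> R) (M : R) :
  (forall t : R, 0 <= t <= 1 -> is_derive t 1 f (df t)) ->
  (forall t : R, 0 <= t <= 1 -> `|df t| <= M) -> `|f 1 - f 0| <= M.
Proof.
move=> fd dM; have [t||c /[!in_itv]/= c01 ->] := @MVT_segment R f df 0 1 ler01.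
- by rewrite in_itv /= => /andP[/ltW ? /ltW ?]; apply: fd; apply/andP.
- by apply: derivable_within_continuous => t /[!in_itv]/= /fd[].
by rewrite subr0 mulr1; exact: dM.
Qed.

Lemma is_derive_mulr (a t : R) : is_derive t 1 (fun s : R => s * a) a.
Proof.
apply: (@is_derive_eq _ _ _ (id * cst a : R -> R)).
by rewrite scaler0 add0r [RHS](_ : a = a *: 1) // [_ *: _]mulr1.
Qed.

Lemma is_derive_sqr (b t : R) : is_derive t 1 (fun s : R => s ^+ 2 * (b / 2)) (t * b).
Proof.
apply: (@is_derive_eq _ _ _ (id * id * cst (b / 2) : R -> R)).
by rewrite scaler0 add0r -[LHS]/((b / 2) * (t * 1 + t * 1)); field.
Qed.

Lemma is_derive_line (V W : normedModType R) (f : V -> W) x h (t : R) df :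
  is_derive (x + t *: h) h f df -> is_derive t 1 (fun s => f (x + s *: h)) df.
Proof.
have E : (fun s : R => s^-1 *: (((fun s => f (x + s *: h)) \o shift t) (s *: 1) - f (x + t *: h))) =
    (fun s => s^-1 *: ((f \o shift (x + t *: h)) (s *: h) - f (x + t *: h))).
  apply/funext => s /=; congr (_ *: (f _ - _)).
  by rewrite [s *: 1]mulr1 scalerDl addrCA.
move=> [fd fE]; split; first by rewrite /derivable E.
by rewrite /derive E.
Qed.

Lemma is_derive_coord (V : normedModType R) n m (f : V -> 'M[R]_(n, m)) x h df i j :
  is_derive x h f df -> is_derive x h (fun y => f y i j) (df i j).
Proof.
move=> [fd <-]; split; first by move/derivable_mxP : fd; exact.
by rewrite (derive_mx fd) mxE.
Qed.

End MeanValue.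

Section Taylor.
Variables (R : realType) (n m : nat) (x0 : 'rV[R]_n) (r e : R).
Hypothesis e_ge0 : 0 <= e.

Lemma segment_ball h t : `|h| < r -> 0 <= t <= 1 -> `|x0 - (x0 + t *: h)| < r.
Proof.
move=> hr /andP[t0 t1]; rewrite opprD addNKr normrN normrZ ger0_norm //.
by apply: le_lt_trans hr; rewrite ler_piMl.
Qed.

(** Mean value theorem for t |-> f (x0 + t h) - t h A, coordinate by coordinate. *)
Lemma first_order_bound (f : 'rV[R]_n -> 'rV[R]_m) (A : 'M[R]_(n, m)) h :
  (forall z, `|x0 - z| < r -> differentiable f z /\ `|'J f z - A| <= e) ->
  `|h| < r -> `|f (x0 + h) - f x0 - h *m A| <= n%:R * e * `|h|.
Proof.
move=> fP hr; apply: norm_le_coord => [|i j]; first by rewrite !mulr_ge0.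
rewrite ord1 {i}.
pose phi t := f (x0 + t *: h) 0 j - t * (h *m A) 0 j.
have -> : (f (x0 + h) - f x0 - h *m A) 0 j = phi 1 - phi 0.
  rewrite /phi scale1r scale0r addr0 mul1r mul0r subr0.
  by move: (h *m A) => hA; rewrite !mxE; ring.
apply: (@mean_value_bound _ _ (fun t => (h *m ('J f (x0 + t *: h) - A)) 0 j)).
  move=> t t01; have [fz _] := fP _ (segment_ball hr t01).
  have -> : (h *m ('J f (x0 + t *: h) - A)) 0 j =
      (h *m 'J f (x0 + t *: h)) 0 j - (h *m A) 0 j.
    by rewrite mulmxBr [LHS]mxE [X in _ + X = _]mxE.
  apply: is_deriveB; last exact: is_derive_mulr.
  have D : is_derive t 1 (fun s : R => f (x0 + s *: h)) (h *m 'J f (x0 + t *: h)).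
    apply: is_derive_line.
    by split; [exact: diff_derivable|rewrite deriveEjacobian].
  exact: (is_derive_coord 0 j D).
move=> t t01; apply: le_trans (coord_le_norm _ _ _) _.
apply: le_trans (norm_mulmx_le _ _) _; rewrite mulrAC ler_wpM2r // ler_wpM2l //.
by have [_] := fP _ (segment_ball hr t01).
Qed.

Section SecondOrder.
Variables (q : 'rV[R]_n -> 'rV[R]_m) (H : 'I_m -> 'M[R]_n).

(** The derivative of the Jacobian in direction h when H i is the Hessian of the
    i-th component. *)
Definition hess_dir (h : 'rV[R]_n) : 'M[R]_(n, m) := \matrix_(l, i) (h *m H i) 0 l.

Lemma hess_dirZ t h l i : hess_dir (t *: h) l i = t * (h *m H i) 0 l.
Proof. by rewrite mxE -scalemxAl mxE. Qed.

Hypothesis qP : forall z, `|x0 - z| < r -> [/\ differentiable q z,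
  differentiable (fun x => 'J q x) z &
  forall i, `|hessian (fun x => q x 0 i) z - H i| <= e].

Lemma jacobian_bound h : `|h| < r ->
  `|'J q (x0 + h) - 'J q x0 - hess_dir h| <= n%:R * e * `|h|.
Proof.
move=> hr; apply: norm_le_coord => [|l i]; first by rewrite !mulr_ge0.
pose phi t := 'J q (x0 + t *: h) l i - t * (h *m H i) 0 l.
have E (J1 J0 D : 'M[R]_(n, m)) : (J1 - J0 - D) l i = J1 l i - J0 l i - D l i.
  by rewrite !mxE.
have -> : ('J q (x0 + h) - 'J q x0 - hess_dir h) l i = phi 1 - phi 0.
  have p1 : phi 1 = 'J q (x0 + h) l i - (h *m H i) 0 l by rewrite /phi scale1r mul1r.
  have p0 : phi 0 = 'J q x0 l i by rewrite /phi scale0r addr0 mul0r subr0.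
  by rewrite p1 p0 E [hess_dir h l i]mxE addrAC.
pose dphi t := (h *m (hessian (fun x => q x 0 i) (x0 + t *: h) - H i)) 0 l.
apply: (@mean_value_bound _ _ dphi) => t t01.
  have [_ Jz _] := qP (segment_ball hr t01).
  have qz : \forall x \near x0 + t *: h, differentiable q x.
    have := near_dist_lt (segment_ball hr t01).
    by apply: filterS => x /qP[].
  have -> : dphi t = ('d (fun x => 'J q x) (x0 + t *: h) h) l i - (h *m H i) 0 l.
    rewrite /dphi mulmxBr (mulmx_hessian_coord qz Jz).
    by move: ('d _ _ _) (h *m _) => ? ?; rewrite !mxE.
  apply: is_deriveB; last exact: is_derive_mulr.
  have D : is_derive t 1 (fun s : R => 'J q (x0 + s *: h)) ('d (fun x => 'J q x) (x0 + t *: h) h).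
    apply: (@is_derive_line _ _ _ (fun x => 'J q x)).
    by split; [exact: diff_derivable|rewrite deriveE].
  exact: (is_derive_coord l i D).
apply: le_trans (coord_le_norm _ _ _) _.
apply: le_trans (norm_mulmx_le _ _) _; rewrite mulrAC ler_wpM2r // ler_wpM2l //.
by have [_ _] := qP (segment_ball hr t01).
Qed.

(** The derivative of t |-> q (x0 + t h) - t h J - t^2 (h H h) / 2 is
    h (J (x0 + t h) - J - hess_dir (t h)), to which jacobian_bound applies; this
    gains one power of |h| over the estimate of the Jacobian. *)
Lemma second_order_bound h : `|h| < r ->
  `|q (x0 + h) - q x0 - h *m 'J q x0 - \row_i (dotp (h *m H i) h / 2)|
  <= n%:R * (n%:R * e) * `|h| ^+ 2.
Proof.
move=> hr; apply: norm_le_coord => [|i j]; first by rewrite !mulr_ge0 ?exprn_ge0.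
rewrite ord1 {i}.
pose a := (h *m 'J q x0) 0 j; pose b := dotp (h *m H j) h.
pose phi t := q (x0 + t *: h) 0 j - t * a - t ^+ 2 * (b / 2).
have -> : (q (x0 + h) - q x0 - h *m 'J q x0 - \row_i (dotp (h *m H i) h / 2)) 0 j
    = phi 1 - phi 0.
  have p1 : phi 1 = q (x0 + h) 0 j - a - b / 2 by rewrite /phi scale1r mul1r expr1n mul1r.
  have p0 : phi 0 = q x0 0 j by rewrite /phi scale0r addr0 mul0r expr0n mul0r !subr0.
  have E (v1 v2 v3 v4 : 'rV[R]_m) : (v1 - v2 - v3 - v4) 0 j =
      v1 0 j - v3 0 j - v4 0 j - v2 0 j by rewrite !mxE; ring.
  by rewrite p1 p0 E [X in _ - X - _]mxE.
pose dphi t := (h *m ('J q (x0 + t *: h) - 'J q x0 - hess_dir (t *: h))) 0 j.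
apply: (@mean_value_bound _ _ dphi) => t t01.
  have [qz _ _] := qP (segment_ball hr t01).
  have -> : dphi t = (h *m 'J q (x0 + t *: h)) 0 j - a - t * b.
    rewrite /dphi /a /b !mulmxBr.
    have -> : t * dotp (h *m H j) h = (h *m hess_dir (t *: h)) 0 j.
      rewrite dotpC dotpE mxE mulr_sumr; apply: eq_bigr => l _.
      by rewrite hess_dirZ mulrCA.
    have E (v1 v2 v3 : 'rV[R]_m) : (v1 - v2 - v3) 0 j = v1 0 j - v2 0 j - v3 0 j.
      by rewrite !mxE.
    exact: E.
  apply: is_deriveB; last exact: is_derive_sqr.
  apply: is_deriveB; last exact: is_derive_mulr.
  have D : is_derive t 1 (fun s : R => q (x0 + s *: h)) (h *m 'J q (x0 + t *: h)).
    apply: is_derive_line.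
    by split; [exact: diff_derivable|rewrite deriveEjacobian].
  exact: (is_derive_coord 0 j D).
have th : `|t *: h| <= `|h|.
  by case/andP: t01 => t0 t1; rewrite normrZ ger0_norm // ler_piMl.
apply: le_trans (coord_le_norm _ _ _) _.
apply: le_trans (norm_mulmx_le _ _) _; rewrite -!mulrA ler_wpM2l // mulrC expr2.
rewrite !mulrA ler_wpM2r //.
apply: le_trans (jacobian_bound (le_lt_trans th hr)) _.
by rewrite ler_wpM2l // mulr_ge0.
Qed.

End SecondOrder.

End Taylor.

Section ApproximateMultipliers.
Variables (R : realType) (n m : nat) (q : 'rV[R]_n -> 'rV[R]_m) (P : set 'rV[R]_m).
Variables (x0 : 'rV[R]_n) (kappa : R).
Hypothesis kappa_gt0 : 0 < kappa.
Hypothesis MR : metrically_regular (fun x : 'rV[R]_n => [set q x - y | y in P]) kappa x0 0.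
Hypothesis q_cont : continuous q.
Hypothesis q_diff : \forall x \near x0, differentiable q x.
Hypothesis Jq_cont : {for x0, continuous (fun x => 'J q x)}.
Hypothesis P_closed : closed P.

(** The bound on lam from the two constructions, made monotone in the norm of the
    gradient f0 so that it is uniform near the reference point. *)
Definition multiplier_radius (f0 : 'rV[R]_n) : R :=
  2 * ((n%:R * `|f0| + 1) * (kappa * m.+1%:R)).

(** Both kinds of stationarity give the same data. A limiting normal is a limit
    of regular normals at points of P near q x0, and these are bounded by
    multiplier_bound; a regular normal to the preimage of P is treated by
    regular_normal_preimage_multiplier. *)
Lemma approximate_multiplier (f0 : 'rV[R]_n) e : 0 < e ->
  (exists2 xi, regular_normal x0 (q @^-1` P) xi & 0 = f0 + xi) \/
  (exists2 lam, limiting_normal (q x0) P lam & 0 = f0 + lam *m ('J q x0)^T) ->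
  exists y lam, [/\ regular_normal y P lam, `|q x0 - y| < e,
    `|f0 + lam *m ('J q x0)^T| <= e & `|lam| <= multiplier_radius f0].
Proof.
move=> e0 []; rewrite /multiplier_radius.
  move=> [xi xiN f0xi].
  have [y [lam [yN yq lamE lamC]]] :=
    regular_normal_preimage_multiplier kappa_gt0 MR q_cont q_diff Jq_cont P_closed xiN e0.
  have xiE : xi = - f0 by apply/eqP; rewrite -addr_eq0 addrC -f0xi.
  exists y, lam; split=> //; first by rewrite addrC -[f0]opprK -xiE.
  by move: lamC; rewrite xiE normrN.
move=> [lam lamN f0lam].
have [r r0 rP] := multiplier_bound kappa_gt0 MR (nbhs_singleton q_diff).
set A := 'J q x0 in f0lam rP *.
have c0 : 0 < kappa * m.+1%:R by rewrite mulr_gt0.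
have a0 : 0 < (n%:R + 1) * (m%:R * `|A| + 1).
  by rewrite mulr_gt0 // ltr_wpDl // mulr_ge0.
pose d := Num.min r (Num.min e (Num.min 1 e / ((n%:R + 1) * (m%:R * `|A| + 1)))).
have d0 : 0 < d by rewrite !lt_min r0 e0 divr_gt0 // lt_min ltr01.
have [dr de da] : [/\ d <= r, d <= e & d * ((n%:R + 1) * (m%:R * `|A| + 1)) <= Num.min 1 e].
  by rewrite -ler_pdivlMr // !ge_min !lexx !orbT.
have [y [lam' [yd lamd lamN']]] := limiting_normal_approx lamN d0.
have dA : `|f0 + lam' *m A^T| <= m%:R * d * `|A|.
  have -> : f0 + lam' *m A^T = (lam' - lam) *m A^T.
    rewrite mulmxBl; move/esym/eqP : f0lam; rewrite addr_eq0 => /eqP ->.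
    by rewrite addrC.
  apply: le_trans (norm_mulmx_le _ _) _; rewrite norm_trmx ler_wpM2r // ler_wpM2l //.
  by rewrite distrC ltW.
have n0 : 0 <= (n%:R : R) by [].
have mA : 0 <= m%:R * `|A| by rewrite mulr_ge0.
have mdA : (n%:R + 1) * (m%:R * d * `|A|) <= Num.min 1 e.
  apply: le_trans da; nra.
have [mdA1 mdAe] : (n%:R + 1) * (m%:R * d * `|A|) <= 1 /\ (n%:R + 1) * (m%:R * d * `|A|) <= e.
  by move: mdA; rewrite le_min => /andP.
have mdA0 : 0 <= m%:R * d * `|A| by rewrite !mulr_ge0 // ltW.
exists y, lam'; split=> //; first exact: lt_le_trans yd _.
  by apply: le_trans dA _; nra.
apply: le_trans (rP y lam' (lt_le_trans yd dr) lamN') _.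
have : `|lam' *m A^T| <= `|f0| + m%:R * d * `|A|.
  rewrite -[X in `|X|](addKr f0) addrC; apply: le_trans (ler_normB _ _) _; lra.
have f00 := normr_ge0 f0.
move: (`|lam' *m A^T|) (m%:R * d * `|A|) mdA0 mdA1 c0 => u v v0 v1 c0 uv.
rewrite [X in X * u]mulrC -mulrA [leRHS]mulrCA [leLHS]mulrC -!mulrA.
rewrite mulrC [_ * (2 * _)]mulrCA.
have : n%:R * u <= n%:R * `|f0| + 1 by nra.
have : 0 <= n%:R * `|f0| by rewrite mulr_ge0.
nra.
Qed.

End ApproximateMultipliers.

(** * Auxiliary facts for the blow-up *)

Section OperatorNorm.
Variables (R : realType) (n m : nat).

Lemma norm_le_opnorm (A : 'M[R]_(n, m)) : `|A| <= opnorm A.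
Proof.
have ub : has_ubound [set enorm (u *m A) | u in @unit_eball R n].
  exists (m.+1%:R * (n%:R * `|A|)) => _ [u /= u1 <-].
  apply: le_trans (enorm_le_norm _) _; rewrite ler_wpM2l //.
  apply: le_trans (norm_mulmx_le _ _) _; rewrite ler_wpM2r //.
  by rewrite ler_piMr //; exact: le_trans (norm_le_enorm u) u1.
have le_op u : enorm u <= 1 -> enorm (u *m A) <= opnorm A.
  by move=> u1; apply: ub_le_sup => //; exists u.
apply: norm_le_coord => [|i j].
  by apply: le_trans (le_op 0 _); rewrite ?enorm_ge0 // /enorm dotp0l sqrtr0 ler01.
have -> : A i j = ((delta_mx 0 i : 'rV[R]_n) *m A) 0 j by rewrite -rowE mxE.
apply: le_trans (coord_le_norm _ _ _) _; apply: le_trans (norm_le_enorm _) _.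
by apply: le_op; rewrite /enorm dotp_delta mxE !eqxx sqrtr1.
Qed.

End OperatorNorm.

(** Makes polyhedron_step and polyhedron_tangent available for cones, where they
    describe the tangent cone of a polyhedral normal cone at one of its elements. *)
Lemma pcone_polyhedron (R : realType) d (s : seq 'rV[R]_d) :
  pcone s = polyhedron (tnth (in_tuple s)) (fun=> 0).
Proof.
apply/seteqP; split=> [x sx j|x sx a /seq_tnthP[j ->]]; last exact: sx.
by apply: sx; exact: mem_tnth.
Qed.

Section SmallLimits.
Context {R : realType} {T : Type} {G : set_system T} {GG : Filter G}.

Lemma cvg0_of_bound m n (C : R) (f : T -> 'M[R]_(m, n)) (g : T -> R) :
  0 <= C -> (\forall z \near G, 0 < g z) ->
  (forall e, 0 < e -> \forall z \near G, `|f z| <= C * e * g z) ->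
  ((g z)^-1 *: f z) @[z --> G] --> (0 : 'M[R]_(m, n)).
Proof.
move=> C0 g0 fg; apply/cvgrPdist_le => e e0.
have C1 : 0 < C + 1 by rewrite ltr_wpDl.
apply: filterS2 g0 (fg (e / (C + 1)) (divr_gt0 e0 C1)) => z gz fz.
rewrite sub0r normrN normrZ gtr0_norm ?invr_gt0 // ler_pdivrMl //.
apply: le_trans fz _; rewrite mulrC ler_pM2l //.
by rewrite mulrCA ler_piMr ?(ltW e0) // ler_pdivrMr // mul1r; lra.
Qed.

End SmallLimits.

Lemma ultra_exists (T : Type) (G : set_system T) (GG : UltraFilter G) p (Q : 'I_p -> T -> Prop) :
  (\forall z \near G, exists i, Q i z) -> exists i, \forall z \near G, Q i z.
Proof.
move=> GQ; have /choice[c cP] i : exists c, \forall z \near G, `[< Q i z >] = c.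
  exact: ultra_decide.
have cP' : \forall z \near G, forall i, `[< Q i z >] = c i by exact: filter_forall.
have [z [[i Qi] cz]] := filter_ex (filterI GQ cP').
by exists i; apply: filterS (cP i) => z' cz'; apply/asboolP; rewrite cz' -cz; exact/asboolP.
Qed.

Section Standing.
Variables (R : realType) (n m : nat) (Omega : topologicalType).
Variables (q : 'rV[R]_n -> Omega -> 'rV[R]_m) (F : 'rV[R]_n -> Omega -> 'rV[R]_n).
Variables (xbar : 'rV[R]_n) (wbar : Omega).
Hypothesis std : standing_assumption q F xbar wbar.

Lemma nbhs_pair_ball (Q : 'rV[R]_n * Omega -> Prop) :
  (\forall z \near (xbar, wbar), Q z) -> exists r W, [/\ 0 < r, nbhs wbar W &
    forall x w, `|xbar - x| < r -> W w -> Q (x, w)].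
Proof.
move=> [[U W] /= [/nbhs_normP[r /= r0 rU] wW] UWQ]; exists r, W; split=> // x w xr Ww.
by apply: UWQ; split => //=; exact: rU.
Qed.

Lemma standing_ball e : 0 < e -> exists r W, [/\ 0 < r, nbhs wbar W &
  forall x w, `|xbar - x| < r -> W w ->
    [/\ differentiable (q ^~ w) x, differentiable (fun x' => jac_x q x' w) x &
        differentiable (F ^~ w) x] /\
    [/\ `|jac_x q x w - jac_x q xbar wbar| <= e,
        `|jac_x F x w - jac_x F xbar wbar| <= e &
        forall i, `|hess_x q i x w - hess_x q i xbar wbar| <= e]].
Proof.
move=> e0; have [U0 [W0 [xU wW diffs [_ _ Jq JF Hq] _]]] := std.
have : \forall z \near (xbar, wbar), [/\ (U0 `*` W0) z,
    `|jac_x q z.1 z.2 - jac_x q xbar wbar| <= e,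
    `|jac_x F z.1 z.2 - jac_x F xbar wbar| <= e &
    forall i, `|hess_x q i z.1 z.2 - hess_x q i xbar wbar| <= e].
  have Jq' : jac_x q z.1 z.2 @[z --> (xbar, wbar)] --> jac_x q xbar wbar by exact: Jq.
  have JF' : jac_x F z.1 z.2 @[z --> (xbar, wbar)] --> jac_x F xbar wbar by exact: JF.
  have Hq' i : hess_x q i z.1 z.2 @[z --> (xbar, wbar)] --> hess_x q i xbar wbar by exact: Hq.
  near=> z; split.
  - by near: z; exists (U0, W0).
  - by rewrite distrC; near: z; move/cvgrPdist_le : Jq'; exact.
  - by rewrite distrC; near: z; move/cvgrPdist_le : JF'; exact.
  - near: z; apply: filter_forall => i.
    by under eq_near do rewrite distrC; move/cvgrPdist_le : (Hq' i); exact.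
move=> /nbhs_pair_ball[r [W [r0 Ww rW]]]; exists r, W; split=> // x w xr Wx.
by have [[Ux Wx'] ? ? ?] := rW x w xr Wx; split=> //; exact: diffs.
Unshelve. all: by end_near. Qed.

End Standing.

(** * Blow-up along violating points *)

Section Blowup.
Variables (R : realType) (n m p : nat) (Omega : topologicalType).
Variables (q : 'rV[R]_n -> Omega -> 'rV[R]_m) (F : 'rV[R]_n -> Omega -> 'rV[R]_n).
Variables (xbar : 'rV[R]_n) (wbar : Omega).
Hypothesis std : standing_assumption q F xbar wbar.
Variables (k : 'I_p -> nat).
Variables (a : forall i, 'I_(k i) -> 'rV[R]_m) (b : forall i, 'I_(k i) -> R).
Let P := polyunion a b.

(* Along the ultrafilter G the parameters w tend to wbar and the points x to
   xbar. With t = |x - xbar|, the perturbations of the data at xbar and the defect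
   of stationarity are o(t), and the points y of P, at which lam is a regular
   normal, satisfy y = q x w + o(t^2). *)
Context {T : Type} {G : set_system T} {GG : UltraFilter G}.
Variables (x : T -> 'rV[R]_n) (w : T -> Omega) (y lam : T -> 'rV[R]_m).
Let h z := x z - xbar.
Let t z := `|h z|.
Let A := jac_x q xbar wbar.
Let JF := jac_x F xbar wbar.
Let H i := hess_x q i xbar wbar.
Let ybar := q xbar wbar.

Hypothesis xw_cvg : (x z, w z) @[z --> G] --> (xbar, wbar).
Hypothesis t_gt0 : \forall z \near G, 0 < t z.
Hypothesis y_close : forall e, 0 < e ->
  \forall z \near G, `|y z - q (x z) (w z)| <= e * t z ^+ 2.
Hypothesis pert_F : forall e, 0 < e ->
  \forall z \near G, `|F xbar (w z) - F xbar wbar| <= e * t z.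
Hypothesis pert_J : forall e, 0 < e ->
  \forall z \near G, `|jac_x q xbar (w z) - A| <= e * t z.
Hypothesis pert_q : forall e, 0 < e ->
  \forall z \near G, `|q xbar (w z) - ybar| <= e * t z.
Hypothesis stat_close : forall e, 0 < e ->
  \forall z \near G, `|F (x z) (w z) + lam z *m (jac_x q (x z) (w z))^T| <= e * t z.
Hypothesis lam_normal : \forall z \near G, regular_normal (y z) P (lam z).

Variables (u : 'rV[R]_n) (lam0 : 'rV[R]_m).
Hypothesis u_lim : (t z)^-1 *: h z @[z --> G] --> u.
Hypothesis lam_lim : lam z @[z --> G] --> lam0.

Lemma near_base r W : 0 < r -> nbhs wbar W ->
  \forall z \near G, `|xbar - x z| < r /\ W (w z).
Proof.
move=> r0 Ww.
have V : nbhs (xbar, wbar) [set v : 'rV[R]_n * Omega | `|xbar - v.1| < r /\ W v.2].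
  exists ([set x | `|xbar - x| < r], W); last by move=> [x' w'] [].
  by split=> //=; exact: (@nbhs_ball_norm _ _ xbar (PosNum r0)).
exact: (xw_cvg V).
Qed.

Lemma t_cvg0 : t z @[z --> G] --> (0 : R).
Proof.
apply/cvgrPdist_lt => e e0; apply: filterS (near_base e0 filterT) => z [xe _].
by rewrite sub0r normrN /t normr_id /h distrC.
Qed.

Lemma cvg0_t m' n' (C : R) (f : T -> 'M[R]_(m', n')) : 0 <= C ->
  (forall e, 0 < e -> \forall z \near G, `|f z| <= C * e * t z) ->
  ((t z)^-1 *: f z) @[z --> G] --> (0 : 'M[R]_(m', n')).
Proof. by move=> C0; exact: cvg0_of_bound. Qed.

Lemma lim_hM l (M : 'M[R]_(n, l)) : (t z)^-1 *: (h z *m M) @[z --> G] --> u *m M.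
Proof.
under eq_fun do rewrite scalemxAl.
by apply: cvg_mulmx => //; exact: cvg_cst.
Qed.

(** f x w - f xbar wbar is h B, plus the error of the first-order expansion in x
    at the fixed parameter w, plus the perturbation of the data; the last two are
    o(t). *)
Lemma first_order_limit l (f : 'rV[R]_n -> Omega -> 'rV[R]_l) (B : 'M[R]_(n, l)) :
  (forall e, 0 < e -> exists r W, [/\ 0 < r, nbhs wbar W & forall x w,
    `|xbar - x| < r -> W w -> differentiable (f ^~ w) x /\ `|jac_x f x w - B| <= e]) ->
  (forall e, 0 < e -> \forall z \near G, `|f xbar (w z) - f xbar wbar| <= e * t z) ->
  (t z)^-1 *: (f (x z) (w z) - f xbar wbar) @[z --> G] --> u *m B.
Proof.
move=> fB fpert.
have -> : (fun z => (t z)^-1 *: (f (x z) (w z) - f xbar wbar)) =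
   (fun z => (t z)^-1 *: (f (x z) (w z) - f xbar (w z) - h z *m B) +
      ((t z)^-1 *: (f xbar (w z) - f xbar wbar) + (t z)^-1 *: (h z *m B))).
  apply/funext => z; rewrite -!scalerDr; congr (_ *: _).
  move: (h z *m B) (f (x z) (w z)) (f xbar (w z)) => v1 v2 v3.
  by apply/rowP => i; rewrite !mxE; ring.
rewrite -[X in _ --> X](add0r (u *m B)) -[X in _ --> X](add0r (0 + u *m B)).
apply: cvgD; last apply: cvgD; last exact: lim_hM.
  apply: (@cvg0_t _ _ n%:R) => // e e0.
  have [r [W [r0 Ww fr]]] := fB _ e0.
  apply: filterS (near_base r0 Ww) => z [xr Wz].
  have := @first_order_bound _ _ _ xbar r e (ltW e0) (f ^~ (w z)) B (h z).
  rewrite {1}/h [xbar + _]addrC subrK; apply; last by rewrite /h distrC.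
  by move=> x' x'r; exact: fr.
by apply: (@cvg0_t _ _ 1) => // e e0; apply: filterS (fpert _ e0) => z; rewrite mul1r.
Qed.

Lemma lim_F : (t z)^-1 *: (F (x z) (w z) - F xbar wbar) @[z --> G] --> u *m JF.
Proof.
apply: first_order_limit => // e e0; have [r [W [r0 Ww rW]]] := standing_ball std e0.
by exists r, W; split=> // x' w' xr Wx; have [[_ _ ?] [_ ? _]] := rW _ _ xr Wx.
Qed.

Lemma lim_q : (t z)^-1 *: (q (x z) (w z) - ybar) @[z --> G] --> u *m A.
Proof.
apply: first_order_limit => // e e0; have [r [W [r0 Ww rW]]] := standing_ball std e0.
by exists r, W; split=> // x' w' xr Wx; have [[? _ _] [? _ _]] := rW _ _ xr Wx.
Qed.

Lemma lim_y : (t z)^-1 *: (y z - ybar) @[z --> G] --> u *m A.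
Proof.
have -> : (fun z => (t z)^-1 *: (y z - ybar)) = (fun z =>
    (t z)^-1 *: (y z - q (x z) (w z)) + (t z)^-1 *: (q (x z) (w z) - ybar)).
  by apply/funext => z; rewrite -scalerDr addrA subrK.
rewrite -[X in _ --> X](add0r (u *m A)); apply: cvgD lim_q.
apply: (@cvg0_t _ _ 1) => // e e0.
have t1 : \forall z \near G, t z <= 1 by have /cvgr_le := t_cvg0; apply; exact: ltr01.
near=> z; rewrite mul1r; apply: (@le_trans _ _ (e * t z ^+ 2)); first by near: z; exact: y_close.
rewrite ler_pM2l // expr2 ler_piMr ?normr_ge0 //; near: z; exact: t1.
Unshelve. all: by end_near. Qed.

Lemma cvg_of_quotient m' n' (f : T -> 'M[R]_(m', n')) (l L : 'M[R]_(m', n')) :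
  (t z)^-1 *: (f z - l) @[z --> G] --> L -> f z @[z --> G] --> l.
Proof.
move=> fL.
have : (t z *: ((t z)^-1 *: (f z - l)) + l) @[z --> G] --> 0 *: L + l.
  by apply: cvgD; [apply: cvgZ => //; exact: t_cvg0|exact: cvg_cst].
rewrite scale0r add0r; apply: cvg_trans; apply: near_eq_cvg.
by apply: filterS t_gt0 => z tz; rewrite scalerA mulfV ?gt_eqF // scale1r subrK.
Qed.

Lemma y_cvg : y z @[z --> G] --> ybar.
Proof. exact: cvg_of_quotient lim_y. Qed.

Lemma lim_J : (t z)^-1 *: (jac_x q (x z) (w z) - A) @[z --> G] --> hess_dir H u.
Proof.
have -> : (fun z => (t z)^-1 *: (jac_x q (x z) (w z) - A)) =
   (fun z => (t z)^-1 *: (jac_x q (x z) (w z) - jac_x q xbar (w z) - hess_dir H (h z)) +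
      ((t z)^-1 *: (jac_x q xbar (w z) - A) + (t z)^-1 *: hess_dir H (h z))).
  apply/funext => z; rewrite -!scalerDr; congr (_ *: _).
  move: (hess_dir _ _) (jac_x q (x z) (w z)) (jac_x q xbar (w z)) => v1 v2 v3.
  by apply/matrixP => i j; rewrite !mxE; ring.
rewrite -[X in _ --> X](add0r (hess_dir H u)) -[X in _ --> X](add0r (0 + hess_dir H u)).
apply: cvgD; last apply: cvgD.
- apply: (@cvg0_t _ _ n%:R) => // e e0.
  have [r [W [r0 Ww rW]]] := standing_ball std e0.
  apply: filterS (near_base r0 Ww) => z [xr Wz].
  have := @jacobian_bound _ _ _ xbar r e (ltW e0) (q ^~ (w z)) H _ (h z).
  rewrite {2}/h [xbar + _]addrC subrK; apply; last by rewrite /h distrC.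
  by move=> x' x'r; have [[? ? _] [_ _ ?]] := rW _ _ x'r Wz.
- by apply: (@cvg0_t _ _ 1) => // e e0; apply: filterS (pert_J e0) => z; rewrite mul1r.
- apply: cvg_from_coord => l i; rewrite mxE.
  under eq_fun do rewrite mxE [hess_dir _ _ _ _]mxE.
  have : ((t z)^-1 *: (h z *m H i)) 0 l @[z --> G] --> (u *m H i) 0 l.
    by apply: cvg_coord; exact: lim_hM.
  by under eq_fun do rewrite mxE.
Qed.

Lemma norm_u : `|u| = 1.
Proof.
have : `|(t z)^-1 *: h z| @[z --> G] --> `|u| by exact: cvg_norm.
move=> un; have un1 : `|(t z)^-1 *: h z| @[z --> G] --> (1 : R).
  apply: (@cvg_trans _ ((fun=> 1 : R) @ G)); last exact: cvg_cst.
  apply: near_eq_cvg; apply: filterS t_gt0 => z tz.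
  by rewrite normrZ gtr0_norm ?invr_gt0 // mulVf // gt_eqF.
exact: cvg_unique un un1.
Qed.

Lemma P_ybar : P ybar.
Proof.
apply: (@closed_cvg _ _ G _ y P) y_cvg; first exact: closed_polyunion.
by apply: filterS lam_normal => z [].
Qed.

Lemma stationarity : F xbar wbar + lam0 *m A^T = 0.
Proof.
have f1 : (F (x z) (w z) + lam z *m (jac_x q (x z) (w z))^T) @[z --> G] -->
    F xbar wbar + lam0 *m A^T.
  apply: cvgD; first exact: cvg_of_quotient lim_F.
  by apply: cvg_mulmx => //; apply: cvg_trmx; exact: cvg_of_quotient lim_J.
have f0 : (F (x z) (w z) + lam z *m (jac_x q (x z) (w z))^T) @[z --> G] --> (0 : 'rV[R]_n).
  apply: (@cvg_of_quotient _ _ _ _ 0); under eq_fun do rewrite subr0.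
  by apply: (@cvg0_t _ _ 1) => // e e0; apply: filterS (stat_close e0) => z; rewrite mul1r.
exact: cvg_unique f1 f0.
Qed.

(** Subtract the limiting stationarity equation from the approximate one and
    divide by t. The difference of lam J^T and lam0 A^T splits into (lam - lam0) A^T
    and lam (J - A)^T, and the second part has a limit after division. *)
Lemma lim_multiplier_quotient :
  (t z)^-1 *: (lam z - lam0) *m A^T @[z --> G] --> - (u *m JF + lam0 *m (hess_dir H u)^T).
Proof.
have E : (fun z => (t z)^-1 *: (lam z - lam0) *m A^T) = (fun z =>
   (t z)^-1 *: (F (x z) (w z) + lam z *m (jac_x q (x z) (w z))^T) -
   ((t z)^-1 *: (F (x z) (w z) - F xbar wbar) +
    lam z *m ((t z)^-1 *: (jac_x q (x z) (w z) - A))^T)).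
  apply/funext => z; rewrite linearZ /= -scalemxAr -scalemxAl -!scalerDr -scalerBr.
  congr (_ *: _); rewrite linearB /= mulmxBr mulmxBl.
  have /eqP := stationarity; rewrite addr_eq0 => /eqP ->.
  have E (v1 v2 v3 v4 : 'rV[R]_n) : v2 - v3 = v4 + v1 - (v4 - - v3 + (v1 - v2)).
    by apply/rowP => i; rewrite !mxE; ring.
  exact: E.
rewrite E -[X in _ --> X]add0r; apply: cvgD.
  by apply: (@cvg0_t _ _ 1) => // e e0; apply: filterS (stat_close e0) => z; rewrite mul1r.
apply: cvgN; apply: cvgD; first exact: lim_F.
by apply: cvg_mulmx => //; apply: cvg_trmx; exact: lim_J.
Qed.

Section NormalCone.
Variable s : seq 'rV[R]_m.
Hypothesis sP : \forall z \near G, regular_normal (y z) P = pcone s.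

(** Any property of the points y is shared by points ybar + t' u' with u' close
    to u A; this serves the tangent cones and the directional normal cone alike. *)
Lemma near_direction (Q : set 'rV[R]_m) e : 0 < e -> (\forall z \near G, Q (y z)) ->
  exists t' u', [/\ 0 < t', t' < e, `|u *m A - u'| < e & Q (ybar + t' *: u')].
Proof.
move=> e0 Qy.
have : \forall z \near G, [/\ 0 < t z, t z < e, `|u *m A - (t z)^-1 *: (y z - ybar)| < e & Q (y z)].
  have te : \forall z \near G, t z < e by have /cvgr_lt := t_cvg0; apply.
  near=> z; split; near: z => //.
  by move/cvgrPdist_lt : lim_y; exact.
move=> /filter_ex[z [tz te ue Qz]]; exists (t z), ((t z)^-1 *: (y z - ybar)); split=> //.
by rewrite scalerA mulfV ?gt_eqF // scale1r addrC subrK.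
Unshelve. all: by end_near. Qed.

Lemma pcone_dir_limiting_normal zeta : pcone s zeta ->
  dir_limiting_normal ybar P (u *m A) zeta.
Proof.
move=> sz; apply: dir_limiting_normalI; first exact: P_ybar.
move=> e e0; have [t' [u' [t0 te ue N]]] :=
  near_direction (Q := fun y => regular_normal y P = pcone s) e0 sP.
by exists t', u', zeta; split; rewrite ?subrr ?normr0 ?N.
Qed.

Lemma pcone_lam0 : pcone s lam0.
Proof. by apply: pcone_limit lam_lim; apply: filterS2 sP lam_normal => z <-. Qed.

(** The quotients (lam - lam0) / t may be unbounded, but they lie in the tangent
    cone at lam0 of the constant normal cone pcone s, and their images under A^T
    converge. As this tangent cone is polyhedral, pcone_image_limit provides mu in
    it with the limit as image. All of pcone s consists of directional limiting
    normals, so that mu is tangent to the directional normal cone as well. *)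
Lemma exists_critical_multiplier :
  exists mu, critical_triple q F P xbar wbar u lam0 mu.
Proof.
pose sT := active (tnth (in_tuple s)) (fun=> 0) lam0.
have [|mu muT muE] := @pcone_image_limit R T G _ m n sT A^T
    (fun z => (t z)^-1 *: (lam z - lam0)) _ _ lim_multiplier_quotient.
  near=> z; apply: pconeZ; first by rewrite invr_ge0 normr_ge0.
  have lamz : pcone s (lam z).
    by near: z; apply: filterS2 sP lam_normal => z <-.
  by apply: polyhedron_tangent; rewrite -pcone_polyhedron //; exact: pcone_lam0.
exists mu; split.
- split; first by move=> u0; have := norm_u; rewrite u0 normr0 => /eqP; rewrite eq_sym oner_eq0.
  apply: contingent_coneI; first exact: P_ybar.
  move=> e e0; apply: near_direction => //.
  by apply: filterS lam_normal => z [].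
- by apply: pcone_dir_limiting_normal; exact: pcone_lam0.
- apply: contingent_coneI; first by apply: pcone_dir_limiting_normal; exact: pcone_lam0.
  move=> e e0; near (0 : R)^'+ => t'; exists t', mu; split.
  + by near: t'; exact: nbhs_right_gt.
  + by near: t'; exact: nbhs_right_lt.
  + by rewrite subrr normr0.
  + apply: pcone_dir_limiting_normal; rewrite pcone_polyhedron; near: t'.
    apply: polyhedron_step => //; rewrite -pcone_polyhedron; exact: pcone_lam0.
- exact: stationarity.
- have [r [W [r0 Ww rW]]] := standing_ball std (@ltr01 R).
  have near_r : \forall x' \near xbar, `|xbar - x'| < r.
    exact: (@nbhs_ball_norm _ _ xbar (PosNum r0)).
  have Wwbar := nbhs_singleton Ww.
  have qd : \forall x' \near xbar, differentiable (q ^~ wbar) x'.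
    by apply: filterS near_r => x' x'r; have [[? _ _] _] := rW x' wbar x'r Wwbar.
  have Jd : differentiable (fun x' => 'J (q ^~ wbar) x') xbar.
    by have [|[_ ? _] _] := rW xbar wbar _ Wwbar; first rewrite subrr normr0.
  have hE : u *m hessian (fun x' => dotp lam0 (q x' wbar)) xbar = lam0 *m (hess_dir H u)^T.
    apply: etrans (mulmx_hessian_dotpE qd Jd lam0 u) _.
    rewrite mulmx_sum_row; apply: eq_bigr => i _; congr (_ *: _).
    by apply/rowP => l; rewrite [RHS]mxE [RHS]mxE [RHS]mxE.
  apply: etrans (congr1 (fun v => u *m jac_x F xbar wbar + v + mu *m A^T) hE) _.
  by rewrite muE subrr.
Unshelve. all: by end_near. Qed.

Hypothesis pert_q2 : forall e, 0 < e ->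
  \forall z \near G, `|q xbar (w z) - ybar| <= e * t z ^+ 2.

Let Q : 'rV[R]_m := \row_i dotp (u *m H i) u.
Let c2 z := (t z ^+ 2)^-1.

Lemma cvg0_t2 d (C : R) (f : T -> 'rV[R]_d) : 0 <= C ->
  (forall e, 0 < e -> \forall z \near G, `|f z| <= C * e * t z ^+ 2) ->
  (2 * c2 z) *: f z @[z --> G] --> (0 : 'rV[R]_d).
Proof.
move=> C0 fC; rewrite -[X in _ --> X](scaler0 _ (2 : R)).
under eq_fun do rewrite -scalerA.
apply: cvgZl_tmp; apply: cvg0_of_bound C0 _ fC.
by apply: filterS t_gt0 => z; exact: exprn_gt0.
Qed.

(** To first order y - ybar is h A; the terms of order t^2 come from the Hessians
    only, since the perturbations of q and of h J are o(t^2). *)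
Lemma second_order_limit :
  (2 * c2 z) *: (y z - ybar - h z *m A) @[z --> G] --> Q.
Proof.
pose r2 z : 'rV[R]_m := \row_i (dotp (h z *m H i) (h z) / 2).
have E : (fun z => (2 * c2 z) *: (y z - ybar - h z *m A)) = (fun z =>
  (2 * c2 z) *: (y z - q (x z) (w z)) +
  ((2 * c2 z) *: (q (x z) (w z) - q xbar (w z) - h z *m jac_x q xbar (w z) - r2 z) +
   ((2 : R) *: (((t z)^-1 *: h z) *m ((t z)^-1 *: (jac_x q xbar (w z) - A))) +
    ((2 * c2 z) *: (q xbar (w z) - ybar) +
     \row_i dotp (((t z)^-1 *: h z) *m H i) ((t z)^-1 *: h z))))).
  apply/funext => z.
  have -> : (2 : R) *: (((t z)^-1 *: h z) *m ((t z)^-1 *: (jac_x q xbar (w z) - A))) =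
      (2 * c2 z) *: (h z *m (jac_x q xbar (w z) - A)).
    by rewrite -scalemxAl -scalemxAr !scalerA -mulrA -expr2 exprVn.
  have -> : \row_i dotp ((t z)^-1 *: h z *m H i) ((t z)^-1 *: h z) = (2 * c2 z) *: r2 z.
    apply/rowP => i; rewrite mxE -scalemxAl dotpZl dotpZr mulrA -expr2 exprVn -/(c2 z).
    by rewrite [RHS]mxE [r2 z 0 i]mxE; field.
  rewrite -!scalerDr; congr (_ *: _); rewrite mulmxBr.
  have E (v1 v2 v3 v4 v5 v6 v7 : 'rV[R]_m) : v1 - v2 - v3 =
      v1 - v4 + (v4 - v5 - v6 - v7 + (v6 - v3 + (v5 - v2 + v7))).
    by apply/rowP => i; rewrite !mxE; ring.
  exact: E.
have QE : Q = 0 + (0 + (0 + (0 + Q))) by rewrite !add0r.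
rewrite E QE.
apply: cvgD; last apply: cvgD; last apply: cvgD; last apply: cvgD.
- by apply: (@cvg0_t2 _ 1) => // e e0; apply: filterS (y_close e0) => z; rewrite mul1r.
- apply: (@cvg0_t2 _ (n%:R * n%:R)) => [|e e0]; first by rewrite mulr_ge0.
  have [r [W [r0 Ww rW]]] := standing_ball std e0.
  apply: filterS (near_base r0 Ww) => z [xr Wz].
  have := @second_order_bound _ _ _ xbar r e (ltW e0) (q ^~ (w z)) H _ (h z).
  rewrite {2}/h [xbar + _]addrC subrK mulrA; apply; last by rewrite /h distrC.
  by move=> x' x'r; have [[? ? _] [_ _ ?]] := rW _ _ x'r Wz.
- rewrite -[X in _ --> X](scaler0 _ (2 : R)); apply: cvgZl_tmp.
  rewrite -[X in _ --> X](mulmx0 _ u); apply: cvg_mulmx => //.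
  by apply: (@cvg0_t _ _ 1) => // e e0; apply: filterS (pert_J e0) => z; rewrite mul1r.
- by apply: (@cvg0_t2 _ 1) => // e e0; apply: filterS (pert_q2 e0) => z; rewrite mul1r.
- apply: cvg_from_coord => i0 i; rewrite mxE; under eq_fun do rewrite mxE.
  by apply: cvg_dotp => //; apply: cvg_mulmx => //; exact: cvg_cst.
Qed.

(** When y is close to ybar, the constraints of the i-th piece that are active at
    y are active at ybar. Hence both ybar - y and y - ybar are tangent to this piece
    at y, and the regular normal lam0 is nonpositive on both. *)
Lemma lam0_orthogonal i : (\forall z \near G, polyhedron (@a i) (@b i) (y z)) ->
  polyhedron (@a i) (@b i) ybar -> \forall z \near G, dotp lam0 (y z - ybar) = 0.
Proof.
move=> Piy Piybar.
have inactive : \forall z \near G, forall j, dotp (@a i j) (y z) = @b i j ->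
    dotp (@a i j) ybar = @b i j.
  apply: filter_forall => j; have [ab|nab] := eqVneq (dotp (@a i j) ybar) (@b i j).
    exact: filterE.
  have lt : dotp (@a i j) ybar < @b i j by rewrite lt_neqAle nab Piybar.
  have : dotp (@a i j) (y z) @[z --> G] --> dotp (@a i j) ybar.
    by apply: cvg_dotp; [exact: cvg_cst|exact: y_cvg].
  move=> /cvgr_lt/(_ _ lt); apply: filterS => z lt' eq.
  by move: lt'; rewrite eq ltxx.
apply: filterS3 sP Piy inactive => z sz Piz act.
have : regular_normal (y z) P lam0 by rewrite sz; exact: pcone_lam0.
move=> /regular_normal_polyunion[_ /(_ i Piz) lamP].
apply/eqP; rewrite eq_le lamP; last first.
  by apply/activeP => j ab; rewrite dotpBr ab (act _ ab) subrr.
by rewrite -oppr_le0 -dotpNr opprB lamP //; exact: polyhedron_tangent.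
Qed.

(** Fix a piece that contains all y. The vectors z = 2 (y - ybar - t u A) / t^2 are
    tangent at u A to the tangent cone of this piece at ybar, and they are orthogonal
    to lam0. With v = 2 (h - t u) / t^2 the differences z - v A converge to the
    Hessian term Q. Although v and z may be unbounded, the set of all z - v A is a
    linear image of a polyhedral cone, so Q = z1 - v1 A for some such v1 and z1.
    Adding a large multiple of u to v1 moves z1 into the tangent cone of the piece at
    ybar; this does not change products with lam0, because lam0 is orthogonal to
    u A. *)
Lemma exists_second_order : exists v,
  second_order_cond q F (fun i => polyhedron (@a i) (@b i)) xbar wbar u lam0 v.
Proof.
have [i Piy] : exists i, \forall z \near G, polyhedron (@a i) (@b i) (y z).
  by apply: ultra_exists; apply: filterS lam_normal => z [[i _ Pi] _]; exists i.
have Piybar : polyhedron (@a i) (@b i) ybar.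
  by apply: (@closed_cvg _ _ G _ y (polyhedron (@a i) (@b i))) y_cvg;
    first exact: closed_polyhedron.
have orth := lam0_orthogonal Piy Piybar.
have lamuA : dotp lam0 (u *m A) = 0.
  have l1 : dotp lam0 ((t z)^-1 *: (y z - ybar)) @[z --> G] --> dotp lam0 (u *m A).
    by apply: cvg_dotp; [exact: cvg_cst|exact: lim_y].
  have l0 : dotp lam0 ((t z)^-1 *: (y z - ybar)) @[z --> G] --> (0 : R).
    apply: (@cvg_trans _ ((fun=> 0 : R) @ G)); last exact: cvg_cst.
    by apply: near_eq_cvg; apply: filterS orth => z oz; rewrite dotpZr oz mulr0.
  exact: cvg_unique l1 l0.
pose si := active (@a i) (@b i) ybar.
have uA_si : pcone si (u *m A).
  apply: pcone_limit lim_y; apply: filterS Piy => z Piz; apply: pconeZ.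
    by rewrite invr_ge0 normr_ge0.
  exact: polyhedron_tangent.
(* directions tangent to pcone si at u A and orthogonal to lam0 *)
pose sC := [seq e <- si | dotp e (u *m A) == 0] ++ [:: lam0; - lam0].
(* pairs (v, z) with z in pcone sC, which the block matrix sends to z - v A *)
pose sB := [seq row_mx (0 : 'rV[R]_n) e | e <- sC].
have [||v0 v0s v0E] := @pcone_image_limit R T G _ (n + m) m sB (col_mx (- A) 1%:M)
  (fun z => row_mx ((2 * c2 z) *: (h z - t z *: u))
                   ((2 * c2 z) *: (y z - ybar - t z *: (u *m A)))) Q.
- apply: filterS3 t_gt0 Piy orth => z tz Piz oz _ /mapP[e eC ->].
  rewrite /dotp tr_row_mx mul_row_col mul0mx add0r -/(dotp _ _) dotpZr.
  apply: mulr_ge0_le0; first by rewrite mulr_ge0 // invr_ge0 exprn_ge0 // ltW.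
  have pos : dotp e (y z - ybar) <= 0 /\ dotp e (u *m A) = 0.
    move: eC; rewrite mem_cat mem_filter !inE => /orP[/andP[/eqP e0 esi]|/orP[]/eqP ->].
    - by split=> //; exact: (polyhedron_tangent Piybar Piz esi).
    - by rewrite oz lamuA.
    - by rewrite !dotpNl oz lamuA oppr0.
  by case: pos => pos e0; rewrite dotpBr dotpZr e0 mulr0 subr0.
- under eq_fun do rewrite mul_row_col mulmx1 mulmxN.
  have E : (fun z => - ((2 * c2 z) *: (h z - t z *: u) *m A) +
       (2 * c2 z) *: (y z - ybar - t z *: (u *m A))) =
     (fun z => (2 * c2 z) *: (y z - ybar - h z *m A)).
    apply/funext => z; rewrite -scalemxAl -scalerN -scalerDr; congr (_ *: _).
    rewrite mulmxBl -scalemxAl.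
    have E (v1 v2 v3 v4 : 'rV[R]_m) : - (v1 - v2) + (v3 - v4 - v2) = v3 - v4 - v1.
      by apply/rowP => j; rewrite !mxE; ring.
    exact: E.
  by rewrite E; exact: second_order_limit.
pose v1 := lsubmx v0; pose z1 := rsubmx v0.
have v0D : v0 = row_mx v1 z1 by rewrite hsubmxK.
have z1E : z1 = v1 *m A + Q.
  by rewrite -v0E v0D mul_row_col mulmx1 mulmxN addNKr.
have z1s : pcone sC z1.
  move=> e eC; have := v0s (row_mx 0 e) (map_f _ eC).
  by rewrite v0D /dotp tr_row_mx mul_row_col mul0mx add0r.
have lamz1 : dotp lam0 z1 = 0.
  apply/eqP; rewrite eq_le z1s ?mem_cat ?inE ?eqxx ?orbT //=.
  by rewrite -oppr_le0 -dotpNl z1s // mem_cat !inE eqxx !orbT.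
(* u A satisfies strictly the constraints of si that are missing in sC, so a
   large multiple of it compensates their violation by z1 *)
have [c c0 zc] : exists2 c, 0 < c & pcone si (z1 + c *: (u *m A)).
  have : \forall d \near (0 : R)^'+, pcone si (u *m A + d *: z1).
    rewrite pcone_polyhedron; apply: polyhedron_step; first by rewrite -pcone_polyhedron.
    apply/activeP => j eq; apply: z1s; rewrite mem_cat mem_filter eq eqxx /=.
    by rewrite (mem_tnth j (in_tuple si)).
  move=> sd; near (0 : R)^'+ => d.
  have d0 : 0 < d by near: d; exact: nbhs_right_gt.
  exists d^-1; first by rewrite invr_gt0.
  have -> : z1 + d^-1 *: (u *m A) = d^-1 *: (u *m A + d *: z1).
    by rewrite scalerDr scalerA mulVf ?gt_eqF // scale1r addrC.
  apply: pconeZ; first by rewrite invr_ge0 ltW.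
  by near: d.
exists (v1 + c *: u); split.
  have -> : (v1 + c *: u) *m jac_x q xbar wbar +
      \row_i0 hess_form (fun x0 => q x0 wbar 0 i0) xbar u = z1 + c *: (u *m A).
    by rewrite mulmxDl -scalemxAl addrAC z1E.
  have iact : active_pieces q (fun i => polyhedron (@a i) (@b i)) xbar wbar u i.
    by apply: contingent_coneI => // e e0; exact: near_direction.
  apply: contingent_coneI; first by exists i.
  move=> e e0; near (0 : R)^'+ => t'; exists t', (z1 + c *: (u *m A)); split.
  + by near: t'; exact: nbhs_right_gt.
  + by near: t'; exact: nbhs_right_lt.
  + by rewrite subrr normr0.
  + by exists i => //; near: t'; exact: polyhedron_step.
have [r [W [r0 Ww rW]]] := standing_ball std (@ltr01 R).
have near_r : \forall x' \near xbar, `|xbar - x'| < r.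
  exact: (@nbhs_ball_norm _ _ xbar (PosNum r0)).
have Wwbar := nbhs_singleton Ww.
have qd : \forall x' \near xbar, differentiable (q ^~ wbar) x'.
  by apply: filterS near_r => x' x'r; have [[? _ _] _] := rW x' wbar x'r Wwbar.
have Jd : differentiable (fun x' => 'J (q ^~ wbar) x') xbar.
  by have [|[_ ? _] _] := rW xbar wbar _ Wwbar; first rewrite subrr normr0.
apply: etrans (hess_form_dotp qd Jd lam0 u) _.
have -> : F xbar wbar = - (lam0 *m A^T) by apply/eqP; rewrite -addr_eq0; exact/eqP/stationarity.
rewrite dotpNl dotp_mulmx trmxK mulmxDl dotpDr -scalemxAl dotpZr lamuA mulr0 addr0.
apply/eqP; rewrite -addr_eq0 addrC -dotpDr; apply/eqP.
by have := lamz1; rewrite z1E.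
Unshelve. all: by end_near. Qed.

End NormalCone.

End Blowup.

(** * Existence of violating points *)

Section Violation.
Variables (R : realType) (n m : nat) (Omega : topologicalType).
Variables (q : 'rV[R]_n -> Omega -> 'rV[R]_m) (F : 'rV[R]_n -> Omega -> 'rV[R]_n).
Variables (xbar : 'rV[R]_n) (wbar : Omega).
Hypothesis q_cont : continuous (fun z : 'rV[R]_n * Omega => q z.1 z.2).
Hypothesis F_cont : continuous (fun z : 'rV[R]_n * Omega => F z.1 z.2).
Hypothesis std : standing_assumption q F xbar wbar.

Lemma tau_hat_bounds l w : [/\ 0 <= tau_hat q F xbar wbar l w,
  e_ q xbar wbar l w <= tau_hat q F xbar wbar l w,
  `|F xbar w - F xbar wbar| <= tau_hat q F xbar wbar l w,
  `|jac_x q xbar w - jac_x q xbar wbar| <= tau_hat q F xbar wbar l w &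
  enorm (q xbar w - q xbar wbar) `^ (l%:R^-1) <= tau_hat q F xbar wbar l w].
Proof.
rewrite /tau_hat /e_.
have f0 := enorm_ge0 (F xbar w - F xbar wbar).
have fn := norm_le_enorm (F xbar w - F xbar wbar).
have jn := norm_le_opnorm (jac_x q xbar w - jac_x q xbar wbar).
have j0 := le_trans (normr_ge0 _) jn.
have p0 := powR_ge0 (enorm (q xbar w - q xbar wbar)) (l%:R^-1).
split; lra.
Qed.

Variables (P : set 'rV[R]_m) (l : nat).
Hypothesis P_closed : closed P.


(** The little-o conditions with a fixed e; the resulting sets shrink with e and
    can therefore generate a filter. *)
Definition asymptotic_bounds (C e : R) (z : 'rV[R]_n * Omega * 'rV[R]_m * 'rV[R]_m) : Prop :=
  let x := z.1.1.1 in let w := z.1.1.2 in let y := z.1.2 in let lam := z.2 in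
  let t := `|x - xbar| in
  [/\ 0 < t, tau_hat q F xbar wbar l w <= e * t,
      regular_normal y P lam /\ `|lam| <= C,
      `|y - q x w| <= e * t ^+ 2 &
      `|F x w + lam *m (jac_x q x w)^T| <= e * t].

Lemma asymptotic_boundsW C e e' z : e <= e' ->
  asymptotic_bounds C e z -> asymptotic_bounds C e' z.
Proof.
move=> ee [t0 tau N yq FN]; split=> //.
- by apply: le_trans tau _; rewrite ler_pM2r.
- by apply: le_trans yq _; rewrite ler_pM2r // exprn_gt0.
- by apply: le_trans FN _; rewrite ler_pM2r.
Qed.

Lemma q_cont_x w : continuous (q ^~ w).
Proof.
move=> x V qV; have /= [[A B] /= [xA wB] AB] := @q_cont (x, w) V qV.
apply: filterS xA => x' Ax'; apply: (AB (x', w)); split=> //=.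
exact: nbhs_singleton.
Qed.

Lemma ball_scale (x z0 : 'rV[R]_n) c : enorm (x - z0) <= c ->
  [set z0 + c *: z | z in @unit_eball R n] x.
Proof.
move=> xc; have c0 : 0 <= c := le_trans (enorm_ge0 _) xc.
have [c00|c00] := eqVneq c 0.
  exists 0; first by rewrite /unit_eball /= /enorm dotp0l sqrtr0 ler01.
  rewrite scaler0 addr0; apply/esym/eqP; rewrite -subr_eq0 -normr_eq0 eq_le normr_ge0 andbT.
  by apply: le_trans (norm_le_enorm _) _; rewrite -c00.
have cgt0 : 0 < c by rewrite lt_neqAle eq_sym c00.
exists (c^-1 *: (x - z0)); last by rewrite scalerA mulfV // scale1r addrC subrK.
by rewrite /unit_eball /= enormZ gtr0_norm ?invr_gt0 // ler_pdivrMl // mulr1.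
Qed.

(** The factor L of the estimate that is violated exceeds gamma, which places x in
    the range of the regularity property, and (n + 1) / e, which makes tau_hat at
    most e t. *)
Lemma violating_points : property_R q P xbar wbar l ->
  ~ local_upper_estimate q F P xbar wbar l ->
  exists C, forall V e, nbhs (xbar, wbar) V -> 0 < e ->
    exists z, V z.1.1 /\ asymptotic_bounds C e z.
Proof.
move=> [U1 [W1 [kappa [gamma [xU1 wW1 kappa0 gamma0 MR]]]]] nest.
exists (multiplier_radius m kappa (F xbar wbar) + 2 * (n%:R * (kappa * m.+1%:R))) => V e Vn e0.
have [r1 [W2 [r10 wW2 rW]]] := standing_ball std (@ltr01 R).
have /nbhs_pair_ball[r2 [W3 [r20 wW3 VFr]]] : \forall z \near (xbar, wbar),
    V z /\ `|F z.1 z.2 - F xbar wbar| <= 1.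
  have Fc : F z.1 z.2 @[z --> (xbar, wbar)] --> F xbar wbar by exact: (@F_cont (xbar, wbar)).
  near=> z; split; near: z; first exact: Vn.
  by under eq_near do rewrite distrC; move/cvgrPdist_le : Fc; apply; exact: ltr01.
have r0 : 0 < Num.min r1 r2 by rewrite lt_min r10.
pose L := Num.max gamma (n.+1%:R / e).
have L0 : 0 < L by rewrite lt_max gamma0.
have [U1P W1P] : nbhs xbar (U1 `&` [set x | `|xbar - x| < Num.min r1 r2]) /\
    nbhs wbar (W1 `&` (W2 `&` W3)).
  split; last by apply: filterI => //; exact: filterI.
  by apply: filterI => //; exact: (@nbhs_ball_norm _ _ xbar (PosNum r0)).
apply: contrapT => none; apply: nest.
exists (U1 `&` [set x | `|xbar - x| < Num.min r1 r2]), (W1 `&` (W2 `&` W3)), L; split=> //.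
move=> w [W1w [W2w W3w]] x [Sx [U1x xr]].
apply: ball_scale; rewrite leNgt; apply/negP => xL; apply: none.
have [tau0 etau _ _ _] := tau_hat_bounds l w.
have [xr1 xr2] : `|xbar - x| < r1 /\ `|xbar - x| < r2.
  by move: xr; rewrite /= lt_min => /andP.
have [Vxw Fxw] := VFr _ _ xr2 W3w.
have [[_ Jx _] _] := rW _ _ xr1 W2w.
have t0 : 0 < `|x - xbar|.
  rewrite normr_gt0; apply: contraTneq xL => ->.
  by rewrite /enorm dotp0l sqrtr0 -leNgt mulr_ge0 // ltW.
have Px : P (q x w) by case: Sx => [[xi [Px _] _]|[lam [Px _] _]].
have MRx : metrically_regular (fun x' => [set q x' w - y | y in P]) kappa x 0.
  apply: MR => //; apply: le_lt_trans xL.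
  apply: ler_pM => //; first exact: ltW.
    by rewrite /e_ addr_ge0 ?powR_ge0 //; exact: le_trans (normr_ge0 _) (norm_le_opnorm _).
  by rewrite le_max lexx.
have qd : \forall x' \near x, differentiable (q ^~ w) x'.
  apply: filterS (near_dist_lt xr1) => x' x'r.
  by have [[? _ _] _] := rW _ _ x'r W2w.
have Jc : {for x, continuous (fun x' => 'J (q ^~ w) x')}.
  exact: (differentiable_continuous Jx).
have e'0 : 0 < Num.min (e * `|x - xbar| ^+ 2) (e * `|x - xbar|).
  by rewrite lt_min !mulr_gt0 // exprn_gt0.
have [y [lam [yN qy FN lamC]]] :=
  approximate_multiplier kappa0 MRx (@q_cont_x w) qd Jc P_closed e'0 Sx.
exists (x, w, y, lam); split=> //; split=> /=.
- exact: t0.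
- have : L * tau_hat q F xbar wbar l w < n.+1%:R * `|x - xbar|.
    by apply: lt_le_trans xL _; exact: enorm_le_norm.
  have : n.+1%:R / e <= L by rewrite le_max lexx orbT.
  rewrite ler_pdivrMr // => nL.
  move=> lt; rewrite -(@ler_pM2l _ L) // mulrA; apply: ltW; apply: lt_le_trans lt _.
  by rewrite ler_pM2r.
- split=> //; apply: le_trans lamC _; rewrite /multiplier_radius -mulrDr.
  rewrite ler_pM2l // -mulrDl ler_pM2r ?mulr_gt0 //.
  have Fn : `|F x w| <= `|F xbar wbar| + 1.
    rewrite -[X in `|X|](subrK (F xbar wbar)) addrC.
    by apply: le_trans (ler_normD _ _) _; rewrite lerD2l.
  have := @ler_wpM2l _ n%:R (ler0n _ n) _ _ Fn; lra.
- by rewrite distrC; apply: ltW; apply: lt_le_trans qy _; rewrite ge_min lexx.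
- by apply: le_trans FN _; rewrite ge_min lexx orbT.
Unshelve. all: by end_near. Qed.

End Violation.

Section Main.
Variables (R : realType) (n m p : nat) (Omega : topologicalType).
Variables (q : 'rV[R]_n -> Omega -> 'rV[R]_m) (F : 'rV[R]_n -> Omega -> 'rV[R]_n).
Variables (xbar : 'rV[R]_n) (wbar : Omega).
Hypothesis q_cont : continuous (fun z : 'rV[R]_n * Omega => q z.1 z.2).
Hypothesis F_cont : continuous (fun z : 'rV[R]_n * Omega => F z.1 z.2).
Hypothesis std : standing_assumption q F xbar wbar.
Variables (k : 'I_p -> nat).
Variables (a : forall i, 'I_(k i) -> 'rV[R]_m) (b : forall i, 'I_(k i) -> R).
Let P := polyunion a b.

(** The parameter space may lack countable neighbourhood bases, so the sets of
    violating points for all pairs (V, e) generate a filter in place of a sequence. *)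
Lemma violating_ultrafilter l : property_R q P xbar wbar l ->
  ~ local_upper_estimate q F P xbar wbar l ->
  exists C (G : set_system ('rV[R]_n * Omega * 'rV[R]_m * 'rV[R]_m)),
  [/\ UltraFilter G, z.1.1 @[z --> G] --> (xbar, wbar) &
      forall e, 0 < e -> \forall z \near G, asymptotic_bounds q F xbar wbar P l C e z].
Proof.
move=> MR nest; have [C CP] :=
  violating_points q_cont F_cont std (@closed_polyunion _ _ _ _ a b) MR nest.
pose D := [set Ve : set ('rV[R]_n * Omega) * R | nbhs (xbar, wbar) Ve.1 /\ 0 < Ve.2].
pose B (Ve : set ('rV[R]_n * Omega) * R) :=
  [set z | Ve.1 z.1.1 /\ asymptotic_bounds q F xbar wbar P l C Ve.2 z].
have FB : ProperFilter (filter_from D B).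
  apply: filter_from_proper; last by move=> [V e] [Vn e0]; exact: CP.
  apply: filter_from_filter; first by exists (setT, 1); split=> /=; [exact: filterT|exact: ltr01].
  move=> [V e] [V' e'] [/= Vn e0] [/= Vn' e'0].
  exists (V `&` V', Num.min e e').
    by split=> /=; [exact: filterI|rewrite lt_min e0].
  move=> z [[/= Vz V'z] bz]; split; split=> //=; apply: asymptotic_boundsW bz => /=.
    by rewrite ge_min lexx.
  by rewrite ge_min lexx orbT.
have [G [GU FG]] := ultraFilterLemma FB.
exists C, G; split=> //.
  move=> V Vn; apply: FG; exists (V, 1); first by split; [exact: Vn|exact: ltr01].
  by move=> z [].
move=> e e0; apply: FG; exists (setT, e); first by split; [exact: filterT|exact: e0].
by move=> z [].
Qed.

(** When l = 2, the square root in the definition of e_ turns tau_hat <= e t into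
    |q xbar w - q xbar wbar| <= (e t)^2, the accuracy that the second-order
    expansion demands. *)
Lemma blowup_limits l : (l = 1 \/ l = 2)%N -> property_R q P xbar wbar l ->
  ~ local_upper_estimate q F P xbar wbar l ->
  exists u lam, (exists mu, critical_triple q F P xbar wbar u lam mu) /\
    (l = 2%N -> exists v, second_order_cond q F (fun i => polyhedron (@a i) (@b i))
       xbar wbar u lam v).
Proof.
move=> l12 MR nest; have [C [G [GU Gcvg Gb]]] := violating_ultrafilter MR nest.
pose x (z : 'rV[R]_n * Omega * 'rV[R]_m * 'rV[R]_m) := z.1.1.1.
pose w (z : 'rV[R]_n * Omega * 'rV[R]_m * 'rV[R]_m) := z.1.1.2.
pose y (z : 'rV[R]_n * Omega * 'rV[R]_m * 'rV[R]_m) := z.1.2.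
pose lam (z : 'rV[R]_n * Omega * 'rV[R]_m * 'rV[R]_m) := z.2.
have xw : (x z, w z) @[z --> G] --> (xbar, wbar).
  move=> V Vn; have GV : \forall z \near G, V z.1.1 by exact: Gcvg.
  by apply: filterS GV => -[[[x' w'] y'] l'].
have t_gt0 : \forall z \near G, 0 < `|x z - xbar|.
  by apply: filterS (Gb 1 ltr01) => z [].
have tau e : 0 < e -> \forall z \near G, tau_hat q F xbar wbar l (w z) <= e * `|x z - xbar|.
  by move=> e0; apply: filterS (Gb e e0) => z [].
have y_close e : 0 < e ->
    \forall z \near G, `|y z - q (x z) (w z)| <= e * `|x z - xbar| ^+ 2.
  by move=> e0; apply: filterS (Gb e e0) => z [].
have stat_close e : 0 < e -> \forall z \near G,
    `|F (x z) (w z) + lam z *m (jac_x q (x z) (w z))^T| <= e * `|x z - xbar|.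
  by move=> e0; apply: filterS (Gb e e0) => z [].
have lam_normal : \forall z \near G, regular_normal (y z) P (lam z).
  by apply: filterS (Gb 1 ltr01) => z [_ _ []].
have lam_bounded : \forall z \near G, `|lam z| <= C.
  by apply: filterS (Gb 1 ltr01) => z [_ _ []].
have pert_F e : 0 < e ->
    \forall z \near G, `|F xbar (w z) - F xbar wbar| <= e * `|x z - xbar|.
  move=> e0; apply: filterS (tau e e0) => z; apply: le_trans.
  by have [] := tau_hat_bounds q F xbar wbar l (w z).
have pert_J e : 0 < e ->
    \forall z \near G, `|jac_x q xbar (w z) - jac_x q xbar wbar| <= e * `|x z - xbar|.
  move=> e0; apply: filterS (tau e e0) => z; apply: le_trans.
  by have [] := tau_hat_bounds q F xbar wbar l (w z).
have tau_q e : 0 < e -> \forall z \near G,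
    enorm (q xbar (w z) - q xbar wbar) `^ (l%:R^-1) <= e * `|x z - xbar|.
  move=> e0; apply: filterS (tau e e0) => z; apply: le_trans.
  by have [] := tau_hat_bounds q F xbar wbar l (w z).
have pert_q2 : l = 2%N -> forall e, 0 < e ->
    \forall z \near G, `|q xbar (w z) - q xbar wbar| <= e * `|x z - xbar| ^+ 2.
  move=> l2 e e0; have e'0 : 0 < Num.min 1 e by rewrite lt_min ltr01.
  apply: filterS (tau_q _ e'0) => z; rewrite l2 powR12_sqrt ?enorm_ge0 // => qt.
  apply: le_trans (norm_le_enorm _) _.
  rewrite -(sqr_sqrtr (enorm_ge0 _)).
  apply: (@le_trans _ _ ((Num.min 1 e * `|x z - xbar|) ^+ 2)).
    by rewrite ler_pXn2r ?nnegrE ?sqrtr_ge0 // mulr_ge0 // ltW.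
  rewrite exprMn ler_wpM2r ?exprn_ge0 //.
  have [m1 me] : Num.min 1 e <= 1 /\ Num.min 1 e <= e by rewrite !ge_min !lexx orbT.
  by apply: le_trans me; rewrite expr2 ler_piMr // ltW.
have pert_q e : 0 < e ->
    \forall z \near G, `|q xbar (w z) - q xbar wbar| <= e * `|x z - xbar|.
  move=> e0; case: l12 => l_eq.
    apply: filterS (tau_q e e0) => z; rewrite l_eq invr1 powRr1 ?enorm_ge0 //.
    exact: le_trans (norm_le_enorm _).
  have t1 : \forall z \near G, `|x z - xbar| <= 1.
    have wT : nbhs wbar [set: Omega] by exact: filterT.
    have := near_base xw (@ltr01 R) wT; apply: filterS => z [zx _].
    by rewrite distrC ltW.
  apply: filterS2 t1 (pert_q2 l_eq e e0) => z t1 /le_trans; apply.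
  by rewrite ler_pM2l // expr2 ler_piMr.
have [u u_lim] : exists u : 'rV[R]_n, `|x z - xbar|^-1 *: (x z - xbar) @[z --> G] --> u.
  apply: (@ultra_bounded_cvg _ G _ _ _ _ 1); apply: filterS t_gt0 => z tz.
  by rewrite normrZ gtr0_norm ?invr_gt0 // mulVf // gt_eqF.
have [lam0 lam_lim] := ultra_bounded_cvg lam_bounded.
have [s sP] : exists s, \forall z \near G, regular_normal (y z) P = pcone s.
  by apply: ultra_regular_normal; apply: filterS lam_normal => z [].
exists u, lam0; split.
  exact: (exists_critical_multiplier std xw t_gt0 y_close pert_F pert_J pert_q
    stat_close lam_normal u_lim lam_lim sP).
move=> l2; exact: (exists_second_order std xw t_gt0 y_close pert_F pert_J pert_q
    stat_close lam_normal u_lim lam_lim sP (pert_q2 l2)).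
Qed.

End Main.

Theorem theorem3 (R : realType) (n m p : nat) (Omega : topologicalType)
    (q : 'rV[R]_n -> Omega -> 'rV[R]_m) (F : 'rV[R]_n -> Omega -> 'rV[R]_n)
    (P_ : 'I_p -> set 'rV[R]_m) (P : set 'rV[R]_m)
    (xbar : 'rV[R]_n) (wbar : Omega)
    (q_cont : continuous (fun z : 'rV[R]_n * Omega => q z.1 z.2))
    (F_cont : continuous (fun z : 'rV[R]_n * Omega => F z.1 z.2))
    (P_poly : forall i, is_polyhedron (P_ i))
    (P_def : P = \bigcup_i P_ i)
    (std : standing_assumption q F xbar wbar)
    (xbar_feas : feasible q P wbar xbar) :
  (property_R q P xbar wbar 1 ->
   ~ (exists (u : 'rV[R]_n) (lambda mu : 'rV[R]_m),
        critical_triple q F P xbar wbar u lambda mu) ->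
   local_upper_estimate q F P xbar wbar 1)
  /\
  (property_R q P xbar wbar 2 ->
   ~ (exists (u : 'rV[R]_n) (lambda mu : 'rV[R]_m) (v : 'rV[R]_n),
        critical_triple q F P xbar wbar u lambda mu /\
        second_order_cond q F P_ xbar wbar u lambda v) ->
   local_upper_estimate q F P xbar wbar 2).
Proof.
have [k [a [b PE]]] : exists (k : 'I_p -> nat) (a : forall i, 'I_(k i) -> 'rV[R]_m)
    (b : forall i, 'I_(k i) -> R), forall i, P_ i = polyhedron (a i) (b i).
  exists (fun i => sval (cid (P_poly i))).
  exists (fun i => sval (cid (svalP (cid (P_poly i))))).
  exists (fun i => sval (cid (svalP (cid (svalP (cid (P_poly i))))))) => i.
  exact: svalP (cid (svalP (cid (svalP (cid (P_poly i)))))).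
have {}PE : P_ = fun i => polyhedron (a i) (b i) by exact/funext.
have {}P_def : P = polyunion a b by rewrite P_def PE.
subst P_ P; split=> MR none; apply: contrapT => nest.
  have [u [lam [[mu crit] _]]] :=
    blowup_limits q_cont F_cont std (or_introl erefl) MR nest.
  by apply: none; exists u, lam, mu.
have [u [lam [[mu crit] /(_ erefl)[v so]]]] :=
  blowup_limits q_cont F_cont std (or_intror erefl) MR nest.
by apply: none; exists u, lam, mu, v.
Qed.
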